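(* Let $A$ be a $0$-definable set in $\mathbb U$ and let $\mathcal G\to A$ be a $0$-definable family of finitely faithful connected groupoids over $A$ in $\mathbb U$. Then there exist a $1$-analysable cover over $A$, $\mathbb U'=(\mathbb U,S,\dots)$, with independent fibres, and a $0$-definable family of connected groupoids over $A$, $\mathcal G'\to A$, in $\mathbb U'$, such that for each $a\in A$: $\mathcal G'_a$ is a one-object extension of $\mathcal G_a$ whose new object is $S_a$, and $\operatorname{Aut}_{\mathcal G'_a}(S_a)$ together with its action on $S_a$ is isomorphic to $\operatorname{Aut}(S_a/\mathbb U)$ with its action on $S_a$.
   Context: $T$ is a complete multi-sorted theory with elimination of imaginaries in language $L$, $\mathbb U$ a monster model; ''definable'' means with parameters. A cover of $\mathbb U$ is a saturated expansion in which $\mathbb U$ is stably embedded (subsets of products of sorts of $\mathbb U$ definable in the expansion are definable in $\mathbb U$). A $1$-analysable cover over $A$ is a cover $\mathbb U'=(\mathbb U,S,\dots)$ by a single new sort $S$, in a language $L'$ finitely generated over $L$ (some $L'_\circ\subseteq L'$ with $L'_\circ\setminus L$ finite has every $L'$-formula equivalent to an $L'_\circ$-formula), with a $0$-definable surjection $S\to A$ each of whose fibres $S_a$ is internal to $\mathbb U$ (in definable bijection, with parameters, with a definable set of $\mathbb U$). $\operatorname{Aut}(S_a/\mathbb U):=\{\sigma|_{S_a}:\sigma\in\operatorname{Aut}(\mathbb U'/\mathbb U)\}$ where $\operatorname{Aut}(\mathbb U'/\mathbb U)$ is the group of automorphisms fixing $\mathbb U$ pointwise; independent fibres means $\sigma\mapsto(\sigma|_{S_a})_{a\in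 A}$ is an isomorphism $\operatorname{Aut}(\mathbb U'/\mathbb U)\to\prod_{a}\operatorname{Aut}(S_a/\mathbb U)$. A definable groupoid $(O_i,f_m)_{i\in I,m\in M}$: definable $I$, $M\to I\times I$ surjective ($M(i,j)$ fibres), $\pi:O\to I$ surjective ($O_i=\pi^{-1}(i)$), $f\subseteq M\times O\times O$ with $f_m$ the graph of a bijection $O_i\to O_j$ for $m\in M(i,j)$, distinct $m$ distinct bijections, closed under composition and inverses; connected if all $M(i,j)\ne\emptyset$; finitely faithful if each object has a finite tuple with trivial pointwise stabiliser in its automorphism group $\{f_m:m\in M(i,i)\}$. A $0$-definable family of connected groupoids over $A$, $\mathcal G\to A$: $0$-definable $I$ with surjection $I\to A$, $M$ with surjection $M\to I\times_A I$, $O$ with surjection $O\to I$, and $f\subseteq M\times_{I\times_A I}(O\times_A O)$ such that for each $a\in A$ the fibres form an $a$-definable connected groupoid $\mathcal G_a$. A one-object extension of $\mathcal G_a$ with new object $X$ is a connected groupoid whose objects are those of $\mathcal G_a$ plus $X$ and which contains $\mathcal G_a$ as the full subcategory on its objects.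
   Formalization: The family G' is 0-definable in U' allowing imaginaries (quotients of 0-definable sets by 0-definable equivalence relations), since real tuples of (U,S) cannot in general code its morphisms; inclusions of G_a and S_a into G'_a are 0-definable injections. *)

(* Defs.v *)
From Stdlib Require List.
From mathcomp Require Import all_boot.
Set Implicit Arguments.
Unset Strict Implicit.
Unset Printing Implicit Defensive.

Record arity (srt : Type) := Arity { len : nat; arg : 'I_len -> srt }.
Arguments arg {srt} a _.

Record language := Language {
  lsort : Type;
  rel_sym : Type;
  fun_sym : Type;
  rel_ar : rel_sym -> arity lsort;
  fun_ar : fun_sym -> arity lsort;
  fun_cod : fun_sym -> lsort
}.
Arguments rel_ar {l} r.
Arguments fun_ar {l} f.
Arguments fun_cod {l} f.

(* Sorts are allowed to be empty. *)
Record structure (L : language) := Structure {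
  carrier :> lsort L -> Type;
  rel_int : forall r : rel_sym L,
    (forall i, carrier (arg (rel_ar r) i)) -> Prop;
  fun_int : forall f : fun_sym L,
    (forall i, carrier (arg (fun_ar f) i)) -> carrier (fun_cod f)
}.
Arguments rel_int {L} s r _.
Arguments fun_int {L} s f _.

(* A context is a type of variables [V] with their sorts [ty : V -> lsort L]; a
   finite [V] stands for a finite product of sorts, and an infinite one is used
   only to name parameters. *)
Definition env (L : language) (N : structure L) (V : Type) (ty : V -> lsort L) :=
  forall v, N (ty v).

Definition ext_ty (S V : Type) (ty : V -> S) (s : S) (v : option V) : S :=
  if v is Some w then ty w else s.

Definition sum_ty (S V W : Type) (ty : V -> S) (ty' : W -> S) (v : V + W) : S :=
  match v with inl w => ty w | inr w => ty' w end.

Definition ext_env (L : language) (N : structure L) (V : Type) (ty : V -> lsort L)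
    (s : lsort L) (e : env N ty) (x : N s) : env N (ext_ty ty s) :=
  fun v => match v return N (ext_ty ty s v) with
           | Some w => e w
           | None => x
           end.

Definition sum_env (L : language) (N : structure L) (V W : Type)
    (ty : V -> lsort L) (ty' : W -> lsort L) (e : env N ty) (e' : env N ty') :
    env N (sum_ty ty ty') :=
  fun v => match v return N (sum_ty ty ty' v) with
           | inl w => e w
           | inr w => e' w
           end.

Definition envl (L : language) (N : structure L) (V W : Type)
    (ty : V -> lsort L) (ty' : W -> lsort L) (e : env N (sum_ty ty ty')) :
    env N ty := fun v => e (inl v).

Definition envr (L : language) (N : structure L) (V W : Type)
    (ty : V -> lsort L) (ty' : W -> lsort L) (e : env N (sum_ty ty ty')) :
    env N ty' := fun v => e (inr v).

Inductive term (L : language) (V : Type) (ty : V -> lsort L) : lsort L -> Type :=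
| Var (v : V) : term ty (ty v)
| App (f : fun_sym L) (args : forall i, term ty (arg (fun_ar f) i)) :
    term ty (fun_cod f).

Inductive formula (L : language) (V : Type) (ty : V -> lsort L) : Type :=
| Bot
| Eq (s : lsort L) (t u : term ty s)
| Rel (r : rel_sym L) (args : forall i, term ty (arg (rel_ar r) i))
| Imp (phi psi : formula ty)
| All (s : lsort L) (phi : @formula L (option V) (ext_ty ty s)).
Arguments Bot {L V ty}.

Fixpoint eval (L : language) (N : structure L) (V : Type) (ty : V -> lsort L)
    (e : env N ty) (s : lsort L) (t : term ty s) : N s :=
  match t in term _ s' return N s' with
  | Var v => e v
  | App f args => fun_int N f (fun i => eval e (args i))
  end.

Fixpoint sat (L : language) (N : structure L) (V : Type) (ty : V -> lsort L)
    (e : env N ty) (phi : formula ty) : Prop :=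
  match phi with
  | Bot => False
  | Eq s t u => eval e t = eval e u
  | Rel r args => rel_int N r (fun i => eval e (args i))
  | Imp phi psi => sat e phi -> sat e psi
  | All s phi => forall x : N s, sat (ext_env e x) phi
  end.

Fixpoint term_in (L : language) (PF : fun_sym L -> Prop)
    (V : Type) (ty : V -> lsort L) (s : lsort L) (t : term ty s) : Prop :=
  match t with
  | Var _ => True
  | App f args => PF f /\ forall i, term_in PF (args i)
  end.

Fixpoint formula_in (L : language) (PR : rel_sym L -> Prop)
    (PF : fun_sym L -> Prop) (V : Type) (ty : V -> lsort L) (phi : formula ty) :
    Prop :=
  match phi with
  | Bot => True
  | Eq s t u => term_in PF t /\ term_in PF u
  | Rel r args => PR r /\ forall i, term_in PF (args i)
  | Imp phi psi => formula_in PR PF phi /\ formula_in PR PF psi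
  | All s phi => formula_in PR PF phi
  end.

Definition definable0 (L : language) (N : structure L) (V : finType)
    (ty : V -> lsort L) (X : env N ty -> Prop) : Prop :=
  exists phi : formula ty, forall e, sat e phi <-> X e.

Definition elt (L : language) (N : structure L) : Type := {s : lsort L & N s}.

Definition elt_ty (L : language) (N : structure L) (B : elt N -> Prop)
    (b : {b : elt N | B b}) : lsort L := projT1 (sval b).

Definition elt_env (L : language) (N : structure L) (B : elt N -> Prop) :
    env N (@elt_ty L N B) := fun b => projT2 (sval b).

Definition definable (L : language) (N : structure L) (V : finType)
    (ty : V -> lsort L) (X : env N ty -> Prop) : Prop :=
  exists phi : formula (sum_ty ty (@elt_ty L N (fun _ => True))),
    forall e, sat (sum_env e (@elt_env L N (fun _ => True))) phi <-> X e.

Definition sentence (L : language) := @formula L void (of_void (lsort L)).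

Definition holds (L : language) (N : structure L) (phi : sentence L) : Prop :=
  forall e, sat (N := N) e phi.

Definition model (L : language) (T : sentence L -> Prop) (N : structure L) :
    Prop := forall phi, T phi -> holds N phi.

Definition entails (L : language) (T : sentence L -> Prop) (phi : sentence L) :
    Prop := forall N : structure L, model T N -> holds N phi.

Definition complete_theory (L : language) (T : sentence L -> Prop) : Prop :=
  (exists N : structure L, model T N) /\
  forall phi, entails T phi \/ entails T (Imp phi Bot).

(* Every class of a 0-definable equivalence relation on a product of sorts is
   [phi(N, b)] for some formula [phi(x, z)] and a unique real tuple [b]. *)
Definition elim_imaginaries (L : language) (N : structure L) : Prop :=
  forall (V : finType) (ty : V -> lsort L) (E : env N ty -> env N ty -> Prop),
    (forall x, E x x) -> (forall x y, E x y -> E y x) ->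
    (forall x y z, E x y -> E y z -> E x z) ->
    definable0 (fun e : env N (sum_ty ty ty) => E (envl e) (envr e)) ->
  forall a : env N ty,
  exists (W : finType) (ty' : W -> lsort L) (phi : formula (sum_ty ty ty')),
  exists! b : env N ty', forall x, sat (sum_env x b) phi <-> E a x.

Definition theory_elim_imaginaries (L : language) (T : sentence L -> Prop) :
    Prop := forall N : structure L, model T N -> elim_imaginaries N.

Definition card_lt (X Y : Type) : Prop := ~ exists f : Y -> X, injective f.

Definition saturated (L : language) (N : structure L) : Prop :=
  forall (B : elt N -> Prop), card_lt {b : elt N | B b} (elt N) ->
  forall (s : lsort L) (p : formula (ext_ty (@elt_ty L N B) s) -> Prop),
    (forall l : seq (formula (ext_ty (@elt_ty L N B) s)),
       (forall phi, List.In phi l -> p phi) ->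
       exists x : N s,
         forall phi, List.In phi l -> sat (ext_env (@elt_env L N B) x) phi) ->
  exists x : N s, forall phi, p phi -> sat (ext_env (@elt_env L N B) x) phi.

(* Saturated in its own cardinality, which is larger than
   [|L| + aleph_0]. *)
Definition monster (L : language) (N : structure L) : Prop :=
  saturated N /\
  card_lt (nat + lsort L + rel_sym L + fun_sym L)%type (elt N).

Record automorphism (L : language) (N : structure L)
    (sigma : forall s, N s -> N s) : Prop := {
  aut_bij : forall s, bijective (sigma s);
  aut_rel : forall r x,
    rel_int N r (fun i => sigma _ (x i)) <-> rel_int N r x;
  aut_fun : forall f x,
    fun_int N f (fun i => sigma _ (x i)) = sigma _ (fun_int N f x)
}.

(* [code e x] says that the tuple [e] represents [x], so [code] presents [X] as a
   subset of a finite product of sorts modulo an equivalence relation.  If both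
   are 0-definable ([imaginary_set]) then [X] is a 0-definable set of N^eq; if
   moreover representatives are unique ([real_set]), it is one of [N] itself.
   The expanded structure need not eliminate imaginaries: the morphisms between
   a fibre of the new sort and an old object are in general only imaginary. *)
Record coding (L : language) (N : structure L) (X : Type) := Coding {
  cvar : finType;
  cty : cvar -> lsort L;
  code : env N cty -> X -> Prop
}.
Arguments cvar {L N X} c.
Arguments cty {L N X} c _.
Arguments code {L N X} c _ _.

Definition zdef_set (L : language) (N : structure L) (X : Type)
    (c : coding N X) (P : X -> Prop) : Prop :=
  definable0 (fun e : env N (cty c) => exists2 x, code c e x & P x).

Definition prod_coding (L : language) (N : structure L) (X Y : Type)
    (c : coding N X) (d : coding N Y) : coding N (X * Y) :=
  @Coding L N (X * Y) (cvar c + cvar d)%type (sum_ty (cty c) (cty d))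
    (fun e xy => code c (envl e) xy.1 /\ code d (envr e) xy.2).

Definition zdef_fun (L : language) (N : structure L) (X Y : Type)
    (c : coding N X) (d : coding N Y) (f : X -> Y) : Prop :=
  zdef_set (prod_coding c d) (fun xy => xy.2 = f xy.1).

Record imaginary_set (L : language) (N : structure L) (X : Type)
    (c : coding N X) : Prop := {
  code_fun : forall e x y, code c e x -> code c e y -> x = y;
  code_surj : forall x, exists e, code c e x;
  code_dom : zdef_set c (fun _ => True);
  code_ker : zdef_set (prod_coding c c) (fun xy => xy.1 = xy.2)
}.

Definition real_set (L : language) (N : structure L) (X : Type)
    (c : coding N X) : Prop :=
  imaginary_set c /\ forall e e' x, code c e x -> code c e' x -> e = e'.

Record groupoid_data := GroupoidData {
  ob : Type;
  mor : Type;
  pt : Type;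
  src : mor -> ob;
  tgt : mor -> ob;
  loc : pt -> ob;
  act : mor -> pt -> pt -> Prop
}.
Arguments src {g} _.
Arguments tgt {g} _.
Arguments loc {g} _.
Arguments act {g} _ _ _.

Record groupoid (G : groupoid_data) : Prop := {
  loc_surj : forall i : ob G, exists x, loc x = i;
  act_dom : forall (m : mor G) x y, act m x y -> loc x = src m /\ loc y = tgt m;
  act_fun : forall (m : mor G) x, loc x = src m -> exists! y, act m x y;
  act_bij : forall (m : mor G) y, loc y = tgt m -> exists! x, act m x y;
  act_inj : forall m m' : mor G, (forall x y, act m x y <-> act m' x y) -> m = m';
  act_comp : forall m m' : mor G, tgt m = src m' ->
    exists m'' : mor G, [/\ src m'' = src m, tgt m'' = tgt m' &
      forall x z, act m'' x z <-> exists y, act m x y /\ act m' y z];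
  act_inv : forall m : mor G,
    exists m' : mor G, [/\ src m' = tgt m, tgt m' = src m &
      forall x y, act m' y x <-> act m x y]
}.

(* The fibre over [a] is the full subcategory on the [i] with [q i = a]. Since
   morphisms stay inside fibres, all fibres are groupoids iff [G] is one. *)
Record connected_family (A : Type) (G : groupoid_data) (q : ob G -> A) : Prop := {
  fam_groupoid : groupoid G;
  fam_surj : forall a, exists i, q i = a;
  fam_mor : forall m : mor G, q (src m) = q (tgt m);
  fam_conn : forall i j, q i = q j -> exists m : mor G, src m = i /\ tgt m = j
}.

Definition finitely_faithful (G : groupoid_data) : Prop :=
  forall i : ob G, exists2 l : seq (pt G), (forall x, List.In x l -> loc x = i) &
    forall m : mor G, src m = i -> tgt m = i ->
      (forall x, List.In x l -> act m x x) ->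
      forall x, loc x = i -> act m x x.

Record zdef_family (L : language) (N : structure L) (A : Type) (cA : coding N A)
    (G : groupoid_data) (q : ob G -> A)
    (cI : coding N (ob G)) (cM : coding N (mor G)) (cO : coding N (pt G)) :
    Prop := {
  zdef_fam : zdef_fun cI cA q;
  zdef_src : zdef_fun cM cI src;
  zdef_tgt : zdef_fun cM cI tgt;
  zdef_loc : zdef_fun cO cI loc;
  zdef_act : zdef_set (prod_coding (prod_coding cM cO) cO)
               (fun t => act t.1.1 t.1.2 t.2)
}.

Record new_symbols (L : language) := NewSymbols {
  nrel : Type;
  nfun : Type;
  nrel_ar : nrel -> arity (option (lsort L));
  nfun_ar : nfun -> arity (option (lsort L));
  nfun_cod : nfun -> option (lsort L)
}.
Arguments nrel_ar {L} n _.
Arguments nfun_ar {L} n _.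
Arguments nfun_cod {L} n _.

Definition some_ar (S : Type) (a : arity S) : arity (option S) :=
  @Arity (option S) (len a) (fun i => Some (arg a i)).

(* The new sort is [None]. *)
Definition expand (L : language) (X : new_symbols L) : language :=
  @Language (option (lsort L)) (rel_sym L + nrel X)%type (fun_sym L + nfun X)%type
    (fun r => match r with inl r => some_ar (rel_ar r) | inr r => nrel_ar X r end)
    (fun f => match f with inl f => some_ar (fun_ar f) | inr f => nfun_ar X f end)
    (fun f => match f with inl f => Some (fun_cod f) | inr f => nfun_cod X f end).

Definition ext_carrier (L : language) (U : structure L) (S : Type)
    (s : option (lsort L)) : Type := if s is Some s' then U s' else S.

Record expansion (L : language) (U : structure L) (X : new_symbols L) :=
  Expansion {
  new_sort : Type;
  nrel_int : forall r : nrel X,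
    (forall i, ext_carrier U new_sort (arg (nrel_ar X r) i)) -> Prop;
  nfun_int : forall f : nfun X,
    (forall i, ext_carrier U new_sort (arg (nfun_ar X f) i)) ->
    ext_carrier U new_sort (nfun_cod X f)
}.
Arguments nrel_int {L U X} e r _.
Arguments nfun_int {L U X} e f _.

Definition exp_str (L : language) (U : structure L) (X : new_symbols L)
    (C : expansion U X) : structure (expand X) :=
  @Structure (expand X) (ext_carrier U (new_sort C))
    (fun r => match r with inl r => rel_int U r | inr r => nrel_int C r end)
    (fun f => match f with inl f => fun_int U f | inr f => nfun_int C f end).

Definition old_ty (L : language) (X : new_symbols L) (V : Type)
    (ty : V -> lsort L) : V -> lsort (expand X) := fun v => Some (ty v).

(* [env U ty] and [env (exp_str C) (old_ty X ty)] are convertible. *)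
Definition lift_coding (L : language) (U : structure L) (X : new_symbols L)
    (C : expansion U X) (Y : Type) (c : coding U Y) : coding (exp_str C) Y :=
  @Coding (expand X) (exp_str C) Y (cvar c) (old_ty X (cty c)) (code c).

Definition new_coding (L : language) (U : structure L) (X : new_symbols L)
    (C : expansion U X) : coding (exp_str C) (new_sort C) :=
  @Coding (expand X) (exp_str C) (new_sort C) unit (fun _ => None)
    (fun e s => e tt = s).

Definition stably_embedded (L : language) (U : structure L) (X : new_symbols L)
    (C : expansion U X) : Prop :=
  forall (V : finType) (ty : V -> lsort L) (D : env U ty -> Prop),
    definable (N := exp_str C) (ty := old_ty X ty) D -> definable D.

Definition finitely_generated (L : language) (U : structure L)
    (X : new_symbols L) (C : expansion U X) : Prop :=
  exists (PR : rel_sym (expand X) -> Prop) (PF : fun_sym (expand X) -> Prop),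
  [/\ exists l : seq (nrel X), forall r, PR (inr r) -> List.In r l,
      exists l : seq (nfun X), forall f, PF (inr f) -> List.In f l &
      forall (V : finType) (ty : V -> lsort (expand X)) (phi : formula ty),
      exists2 psi : formula ty, formula_in PR PF psi &
        forall e : env (exp_str C) ty, sat e phi <-> sat e psi].

Definition internal (L : language) (U : structure L) (X : new_symbols L)
    (C : expansion U X) (P : new_sort C -> Prop) : Prop :=
  exists (V : finType) (ty : V -> lsort L) (D : env U ty -> Prop)
         (F : new_sort C -> env U ty -> Prop),
  [/\ definable D,
      definable (N := exp_str C)
        (ty := ext_ty (old_ty X ty) (None : lsort (expand X)))
        (fun e => F (e None) (fun v => e (Some v))),
      forall s d, F s d -> P s /\ D d,
      forall s, P s -> exists! d, F s d &
      forall d, D d -> exists! s, F s d].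

Record analysable_cover (L : language) (U : structure L) (A : Type)
    (cA : coding U A) (X : new_symbols L) (C : expansion U X)
    (p : new_sort C -> A) : Prop := {
  cover_sat : saturated (exp_str C);
  cover_emb : stably_embedded C;
  cover_fg : finitely_generated C;
  cover_surj : forall a, exists s, p s = a;
  cover_zdef : zdef_fun (new_coding C) (lift_coding C cA) p;
  cover_int : forall a, internal (fun s => p s = a)
}.

Section Automorphisms.
Variables (L : language) (U : structure L) (X : new_symbols L).
Variables (C : expansion U X) (A : Type) (p : new_sort C -> A).

Definition aut_over (sigma : forall s, exp_str C s -> exp_str C s) : Prop :=
  automorphism sigma /\
  forall (s : lsort L) (x : U s),
    sigma (Some s : lsort (expand X)) x = x.

Definition fibre (a : A) : Type := {s : new_sort C | p s = a}.

Definition restricts (sigma : forall s, exp_str C s -> exp_str C s) (a : A)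
    (g : fibre a -> fibre a) : Prop :=
  forall s : fibre a, sval (g s) = sigma (None : lsort (expand X)) (sval s).

Definition aut_fibre (a : A) : Type :=
  {g : fibre a -> fibre a |
    exists2 sigma, aut_over sigma & restricts sigma g}.

(* The restriction map to the product is evidently a homomorphism, so being an
   isomorphism means being bijective. *)
Definition independent_fibres : Prop :=
  forall g : (forall a, aut_fibre a),
  exists sigma, [/\ aut_over sigma,
    forall a, restricts sigma (sval (g a)) &
    forall tau, aut_over tau -> (forall a, restricts tau (sval (g a))) ->
      forall s x, tau s x = sigma s x].

(* Disjoint unions of sets in different sorts exist only up to bijection, so the
   extension of G comes with inclusions [jo], [jp] of the objects and points of
   G, the new object [star a] over each [a], and the identification [k] of
   [fibre a] with the set of points of [star a].  Morphisms are identified with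
   the bijections they induce. *)
Record one_object_extension (G : groupoid_data) (q : ob G -> A)
    (G' : groupoid_data) (q' : ob G' -> A)
    (jo : ob G -> ob G') (jp : pt G -> pt G') (star : A -> ob G')
    (k : new_sort C -> pt G') (a : A) : Prop := {
  ext_ob : forall i' : ob G',
    q' i' = a <-> (exists2 i, q i = a & jo i = i') \/ i' = star a;
  ext_ob_inj : forall i j, q i = a -> q j = a -> jo i = jo j -> i = j;
  ext_ob_new : forall i, q i = a -> jo i <> star a;
  ext_pt : forall i, q i = a -> forall x' : pt G',
    loc x' = jo i <-> exists2 x, loc x = i & jp x = x';
  ext_pt_inj : forall x y, q (loc x) = a -> q (loc y) = a -> jp x = jp y -> x = y;
  ext_new : forall x' : pt G',
    loc x' = star a <-> exists2 s, p s = a & k s = x';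
  ext_new_inj : forall s t, p s = a -> p t = a -> k s = k t -> s = t;
  ext_mor : forall i j, q i = a -> q j = a -> forall m : mor G,
    src m = i -> tgt m = j ->
    exists m' : mor G', [/\ src m' = jo i, tgt m' = jo j &
      forall x y, loc x = i -> loc y = j ->
        (act m x y <-> act m' (jp x) (jp y))];
  ext_full : forall i j, q i = a -> q j = a -> forall m' : mor G',
    src m' = jo i -> tgt m' = jo j ->
    exists m : mor G, [/\ src m = i, tgt m = j &
      forall x y, loc x = i -> loc y = j ->
        (act m x y <-> act m' (jp x) (jp y))]
}.

Definition vertex_group (G : groupoid_data) (i : ob G) : Type :=
  {m : mor G | src m = i /\ tgt m = i}.

(* An isomorphism of groups compatible with the two actions on [fibre a]. *)
Definition action_isomorphic (G' : groupoid_data) (star : A -> ob G')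
    (k : new_sort C -> pt G') (a : A) : Prop :=
  exists phi : vertex_group (star a) -> aut_fibre a,
  [/\ bijective phi,
      forall m1 m2 m3 : vertex_group (star a),
        (forall x z, act (sval m3) x z <->
           exists y, act (sval m1) x y /\ act (sval m2) y z) ->
        forall s, sval (phi m3) s = sval (phi m2) (sval (phi m1) s) &
      forall (m : vertex_group (star a)) (s : fibre a),
        act (sval m) (k (sval s)) (k (sval (sval (phi m) s)))].

End Automorphisms.

(* Main.v *)
Require Import Defs.
From mathcomp Require Import all_boot.
From mathcomp Require Import boolp.
From mathcomp Require classical_sets.
Set Implicit Arguments.
Unset Strict Implicit.
Unset Printing Implicit Defensive.

(* Choose an object i(a) of each G_a, let S_a be a copy of O_{i(a)} and
   let S be their union.  By saturation there is a uniform n such that every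
   object has a faithful n-tuple, so one new relation between (n+1)-tuples of O
   and of S, "some morphism of G maps the first to the second", recovers every
   bijection O_i -> S_a from its values on a faithful tuple.

   A formula about (U, S) is translated into a formula about U by replacing the
   elements of S by the points of O they are copies of.  A quantifier over S
   becomes a quantifier over those points of O that lie in the same object as
   every free variable over the same a; this is correct because changing the
   section i along morphisms of G is an isomorphism of covers.  Since the
   translation does not depend on i, stable embeddedness and saturation of the
   cover follow from those of U.  The same isomorphisms, from i to itself, show
   that automorphisms over U are arbitrary families of elements of the vertex
   groups at the i(a), which gives independent fibres.  Morphisms of the extended
   groupoid are coded by a faithful tuple together with its image. *)

(** The section [i] is obtained from the axiom of choice, with no definability, so nothing about the
    cover may be read off from [i] itself; hence the translation is stated for all sections at once.
    Its quantifier step rests on a dichotomy: a point over [a] compatible with the free variables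
    either lies in [i a], or no relevant variable of the new sort lies over [a], and then [i] may be
    altered at [a] alone. For one formula this is a finite conjunction of compatibility conditions;
    for a type such a condition is added for every parameter. Saturation of the cover is measured by
    its own cardinality. Each parameter of the new sort becomes a finite tuple of [U], and small
    sets must stay small under this replacement; for infinite [X] this rests on an injection of
    [X * X] into [X], obtained here from Zorn's lemma. A faithful tuple in an object is not
    canonical, so one morphism of the extended groupoid has many codes. They are identified when
    they define the same graph, and the coding of morphisms is therefore imaginary. *)

(** * Cardinalities compared by injections; [card_lt X Y] is the negation of [embeds Y X] *)

Definition embeds (X Y : Type) : Prop := exists f : X -> Y, injective f.

Lemma embeds_trans (X Y Z : Type) : embeds X Y -> embeds Y Z -> embeds X Z.
Proof. by move=> [f fi] [g gi]; exists (g \o f); apply: inj_comp. Qed.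

Lemma embeds_rel (X Y : Type) (R : X -> Y -> Prop) :
  (forall x, exists y, R x y) ->
  (forall x x' y, R x y -> R x' y -> x = x') -> embeds X Y.
Proof.
move=> /choice [f Rf] Ri; exists f => x x' e.
by apply: (Ri x x' (f x)) => //; rewrite e.
Qed.

Lemma embeds_surj (X Y : Type) (f : X -> Y) :
  (forall y, exists x, f x = y) -> embeds Y X.
Proof.
move=> fs; apply: (embeds_rel (R := fun y x => f x = y)) => // y y' x.
by move=> <- <-.
Qed.

Lemma embeds_prod (X Y X' Y' : Type) :
  embeds X X' -> embeds Y Y' -> embeds (X * Y) (X' * Y').
Proof.
move=> [f fi] [g gi]; exists (fun z => (f z.1, g z.2)).
by move=> [x y] [x' y'] /= [/fi -> /gi ->].
Qed.

(** Zorn's lemma gives a maximal graph of a partial injection. If it missed an element on both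
    sides, adding that pair would extend it. *)
Lemma embeds_total (X Y : Type) : embeds X Y \/ embeds Y X.
Proof.
pose P (F : X * Y -> Prop) := forall t u, F t -> F u -> (t.1 = u.1 <-> t.2 = u.2).
have [|F [PF maxF]] := @classical_sets.Zorn_bigcup _ P.
  move=> H HP Htot t u [F HF Ft] [K HK Ku].
  by have [FK|KF] := Htot _ _ HF HK;
    [apply: (HP _ HK) => //; apply: FK | apply: (HP _ HF) => //; apply: KF].
have [allX|/existsNP[x0 nx0]] := EM (forall x, exists y, F (x, y)).
  left; apply: (embeds_rel allX) => x x' y Fx Fx'.
  exact: (PF _ _ Fx Fx').2.
have [allY|/existsNP[y0 ny0]] := EM (forall y, exists x, F (x, y)).
  right; apply: (embeds_rel allY) => y y' x Fx Fx'.
  exact: (PF _ _ Fx Fx').1.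
exfalso; apply: (maxF (fun t => F t \/ t = (x0, y0))).
  split=> [t Ft|sub]; first by left.
  by apply: nx0; exists y0; apply: sub; right.
move=> [x y] [x' y'] /= [Ft|[-> ->]] [Fu|[-> ->]] //; first exact: PF Ft Fu.
- by split=> e; exfalso; [apply: nx0; exists y; rewrite -e
                        | apply: ny0; exists x; rewrite -e].
- by split=> e; exfalso; [apply: nx0; exists y'; rewrite e
                        | apply: ny0; exists x'; rewrite e].
Qed.

Section Square.
Variables (X : Type) (h : nat -> X).
Hypothesis h_inj : injective h.

Let D (F : X * X * X -> Prop) (x : X) := exists z, F (x, x, z).

(* [F] is the graph of an injection from [D F * D F] to [D F]. *)
Let good (F : X * X * X -> Prop) :=
  [/\ forall x y z, F (x, y, z) -> [/\ D F x, D F y & D F z],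
      forall x y, D F x -> D F y -> exists z, F (x, y, z) &
      forall t u, F t -> F u -> (t.1 = u.1 <-> t.2 = u.2)].

(** The coding of pairs of natural numbers, transported along [h]. Keeping it inside every graph
    provides the elements [h 0] and [h 1] of the domain, later used as tags. *)
Let F0 (t : X * X * X) :=
  exists a b, t = (h a, h b, h (pickle (a, b))).

Let good_F0 : good F0.
Proof.
have DF0 x : D F0 x <-> exists a, x = h a.
  split=> [[z [a [b [-> _ _]]]]|[a ->]]; first by exists a.
  by exists (h (pickle (a, a))), a, a.
split.
- by move=> x y z [a [b [-> -> ->]]]; split; apply/DF0;
    [exists a|exists b|exists (pickle (a, b))].
- by move=> x y /DF0[a ->] /DF0[b ->]; exists (h (pickle (a, b))), a, b.
- move=> _ _ [a [b ->]] [a' [b' ->]] /=; split=> [[/h_inj -> /h_inj ->] //|/h_inj].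
  by move/(pcan_inj pickleK) => [-> ->].
Qed.

(** Zorn's lemma is applied to those [F] for which [U2 F] is good, so that the resulting maximal
    graph contains [F0] by construction. *)
Let U2 (F : X * X * X -> Prop) t := F0 t \/ F t.

Let good_max : exists F, [/\ good F, (forall t, F0 t -> F t) &
  forall K, good K -> (forall t, F t -> K t) -> forall t, K t -> F t].
Proof.
have [|F [PF maxF]] := @classical_sets.Zorn_bigcup _ (fun F => good (U2 F)).
  move=> H HP Htot; set V := classical_sets.bigcup _ _.
  (* Any two triples of the union of a chain already lie in one good member, and each clause of
     [good] involves at most two triples. *)
  have gl t u : U2 V t -> U2 V u -> exists F,
      [/\ good F, (forall t, F t -> U2 V t), F t & F u].
    have sub F : H F -> forall t, U2 F t -> U2 V t.
      by move=> HF v [|Fv]; [left|right; exists F].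
    move=> [t0|[F HF Ft]] [u0|[K HK Ku]].
    - by exists F0; split=> // v; left.
    - exists (U2 K); split; [exact: HP|exact: sub|by left|by right].
    - exists (U2 F); split; [exact: HP|exact: sub|by right|by left].
    - have [FK|KF] := Htot _ _ HF HK.
        exists (U2 K); split; [exact: HP|exact: sub|by right; apply: FK|by right].
      exists (U2 F); split; [exact: HP|exact: sub|by right|by right; apply: KF].
  have DS F x : (forall t, F t -> U2 V t) -> D F x -> D (U2 V) x.
    by move=> sub [z Fz]; exists z; apply: sub.
  split.
  - move=> x y z Vt; have [F [[g1 _ _] sub Ft _]] := gl _ _ Vt Vt.
    by have [dx dy dz] := g1 _ _ _ Ft; split; apply: (DS F).
  - move=> x y [z Vx] [w Vy]; have [F [[_ g2 _] sub Fx Fy]] := gl _ _ Vx Vy.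
    have [||v Fv] := g2 x y; [by exists z|by exists w|].
    by exists v; apply: sub.
  - move=> t u Vt Vu; have [F [[_ _ g3] _ Ft Fu]] := gl _ _ Vt Vu.
    exact: g3.
exists (U2 F); split=> //; first by move=> t; left.
move=> K gK FK t Kt; apply: contrapT => nt; apply: (maxF K).
  split=> [u Fu|sub]; first by apply: FK; right.
  by apply: nt; right; apply: sub.
suff -> : U2 K = K by [].
apply: funext => u; apply: propext; split=> [[u0|//]|]; last by right.
by apply: FK; left.
Qed.

(** Let [F] be a maximal good graph. If the complement of [D F] injects into [D F], then [X] injects
    into two tagged copies of [D F], hence into [D F], and the pairing on [D F] finishes. The other
    case contradicts maximality. *)
Lemma embeds_square : embeds (X * X) X.
Proof.
have [F [gF F0F maxF]] := good_max; have [g1 g2 g3] := gF.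
pose T := {x | D F x}.
have /choice [f fP] (t : T * T) : exists z : T, F (sval t.1, sval t.2, sval z).
  case: t => -[x dx] [y dy] /=; have [z Fz] := g2 _ _ dx dy.
  by have [_ _ dz] := g1 _ _ _ Fz; exists (exist _ z dz).
have sinj (P : X -> Prop) (a b : {x | P x}) : sval a = sval b -> a = b.
  by case: a b => x p [y r] /= e; subst y; congr exist.
have f_inj : injective f.
  move=> t u e; have /= := (g3 _ _ (fP t) (fP u)).2; rewrite e => /(_ erefl) [].
  by case: t u {e} => x y [x' y'] /= /sinj -> /sinj ->.
have dh n : D F (h n) by exists (h (pickle (n, n))); apply: F0F; exists n, n.
pose c (n : nat) : T := exist _ (h n) (dh n).
have c_inj : injective c by move=> a b [] /h_inj.
have [[g gi]|[g gi]] := embeds_total {x | ~ D F x} T.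
  have XT : embeds X T.
    pose k (x : X) : T := match pselect (D F x) with
      | left d => f (c 0, exist _ x d) | right d => f (c 1, g (exist _ x d)) end.
    exists k => x y; rewrite /k; case: pselect => dx; case: pselect => dy /f_inj [] //.
    - by move=> /h_inj.
    - by move=> /h_inj.
    - by move=> /gi [].
  apply: (embeds_trans (embeds_prod XT XT)); apply: (@embeds_trans _ T).
    by exists f.
  by exists sval; apply: sinj.
(* A copy of [D F] outside [D F] would let [F] be extended to the union. *)
exfalso.
pose D' x := exists t : T, x = sval (g t).
have nDD' x : D F x -> D' x -> False.
  by move=> d [t xE]; move: d; rewrite xE; apply: (svalP (g t)).
pose W x := D F x \/ D' x.
(* [dec x t n] reads: [x] is [t] itself for [n = 0], and the copy of [t] outside [D F] for
   [n = 1]. *)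
pose dec (x : X) (t : T) (n : nat) := (x = sval t /\ n = 0) \/ (x = sval (g t) /\ n = 1).
have decx x t n x' t' n' : dec x t n -> dec x' t' n' ->
    (x = x' <-> (t, n) = (t', n')).
  move=> [[-> ->]|[-> ->]] [[-> ->]|[-> ->]].
  - by split=> [/sinj->|[->]].
  - split=> // e; exfalso; apply: (nDD' (sval t)); first exact: svalP t.
    by exists t'.
  - split=> // e; exfalso; apply: (nDD' (sval t')); first exact: svalP t'.
    by exists t.
  - by split=> [/sinj/gi->|[->]].
have Wdec x : W x <-> exists t n, dec x t n.
  split=> [[d|[t ->]]|[t [n [[-> _]|[-> _]]]]].
  - by exists (exist _ x d), 0; left.
  - by exists t, 1; right.
  - by left; apply: svalP.
  - by right; exists t.
(* Pairs with at least one entry in the copy ([0 < n + n']) are sent into the copy, away from all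
   values of [F]; the value codes both elements and both tags. *)
pose N (u : X * X * X) := exists t t' n n', [/\ dec u.1.1 t n, dec u.1.2 t' n',
  0 < n + n' & u.2 = sval (g (f (f (t, t'), f (c n, c n'))))].
pose K u := F u \/ N u.
have WK x : D K x <-> W x.
  split=> [[z [Fz|[t [t' [n [n' /= [d1 _ _ _]]]]]]]|[[z Fz]|[t ->]]].
  - by left; exists z.
  - by apply/Wdec; exists t, n.
  - by exists z; left.
  - exists (sval (g (f (f (t, t), f (c 1, c 1))))); right; exists t, t, 1, 1.
    by split=> //=; right.
have gK : good K.
  split.
  - move=> x y z [Fz|[t [t' [n [n' /= [d1 d2 _ ->]]]]]]; split; apply/WK.
    + by left; case: (g1 _ _ _ Fz).
    + by left; case: (g1 _ _ _ Fz).
    + by left; case: (g1 _ _ _ Fz).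
    + by apply/Wdec; exists t, n.
    + by apply/Wdec; exists t', n'.
    + by right; eexists.
  - move=> x y /WK Wx /WK Wy; have /Wdec [t [n d1]] := Wx; have /Wdec [t' [n' d2]] := Wy.
    have [nn|] := posnP (n + n'); last first.
      by move=> p; eexists; right; exists t, t', n, n'; split.
    have [z Fz] : exists z, F (x, y, z).
      apply: g2; move: nn.
        by case: d1 => -[-> ->] // _; apply: svalP.
      by case: d2 => -[-> ->] //; rewrite ?addn1 // => _; apply: svalP.
    by exists z; left.
  - have FN u v : F u -> N v -> ~ (u.1 = v.1) /\ ~ (u.2 = v.2).
      move=> Fu [t [t' [n [n' [d1 d2 nn e]]]]]; case: u Fu => -[x y] z Fu /=.
      have [dx dy dz] := g1 _ _ _ Fu; split=> E.
        move: d1 d2 nn; rewrite -E /= => -[[_ ->]|[e1 _]]; last first.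
          by exfalso; apply: (nDD' x) => //; exists t.
        move=> [[_ ->]|[e1 _]] //.
        by exfalso; apply: (nDD' y) => //; exists t'.
      by apply: (nDD' z) => //; rewrite E e; eexists.
    move=> u v [Fu|Nu] [Fv|Nv]; first exact: g3.
    + by have [a b] := FN _ _ Fu Nv.
    + by have [a b] := FN _ _ Fv Nu; split=> e; exfalso; [apply: a|apply: b].
    + move: Nu Nv; case: u v => -[x y] z [[x' y'] z'].
      move=> [t [u [n [m /= [d1 d2 _ ->]]]]] [t' [u' [n' [m' /= [d1' d2' _ ->]]]]].
      split=> [[]|].
        by move=> /(decx _ _ _ _ _ _ d1 d1') [-> ->] /(decx _ _ _ _ _ _ d2 d2') [-> ->].
      move=> /sinj /gi /f_inj [/f_inj [e1 e2] /f_inj [/h_inj e3 /h_inj e4]].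
      by subst t' u' n' m'; congr (_, _);
        [apply/(decx _ _ _ _ _ _ d1)|apply/(decx _ _ _ _ _ _ d2)]; eauto.
have := maxF K gK (fun t => @or_introl _ _) => KF.
have /WK [z /KF Fz] : W (sval (g (c 0))) by right; exists (c 0).
by apply: (nDD' (sval (g (c 0)))); [exists z|exists (c 0)].
Qed.

End Square.

Lemma embeds_nat_of_card_lt (X : Type) : card_lt nat X -> embeds nat X.
Proof. by move=> nX; case: (embeds_total nat X) => // /nX. Qed.

Lemma embeds_sum (X Y Z : Type) :
  embeds nat Z -> embeds X Z -> embeds Y Z -> embeds (X + Y) Z.
Proof.
move=> [h hi] [f fi] [g gi]; apply: embeds_trans (embeds_square hi).
exists (fun t => match t with inl x => (h 0, f x) | inr y => (h 1, g y) end).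
by move=> [x|y] [x'|y'] [] => [/fi->|/hi|/hi|/gi->].
Qed.

Lemma embeds_fun (F : finType) (X : Type) : embeds nat X -> embeds (F -> X) X.
Proof.
move=> nX; have [h hi] := nX; have [k ki] := embeds_square hi.
have [g gP] : exists g : (F -> X) -> X, forall f f', g f = g f' ->
    {in enum F, f =1 f'}.
  elim: (enum F) => [|w l [g gP]]; first by exists (fun _ => h 0).
  exists (fun f => k (f w, g f)) => f f' /ki [e1 /gP e2] v.
  by rewrite inE => /orP[/eqP->|/e2].
exists g => f f' /gP e; apply: funext => w; apply: e; exact: mem_enum.
Qed.

(** Bounds the parameters of a translated type: [V] are the parameters in the cover, [Y] the
    elements of the cover, [X] those of [U], and [F] bounds the coordinates of one parameter. For
    infinite [V] the factor [F] is absorbed by [V * V]; otherwise the product is countable. *)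
Lemma card_lt_mul_fin (V : Type) (F : finType) (X Y Z : Type) :
  card_lt nat X -> embeds Z (V * F) -> embeds Y X -> card_lt V Y -> card_lt Z X.
Proof.
move=> nX ZVF YX VY XZ; have [nV|[f fi]] := embeds_total nat V.
  have [h hi] := nV.
  apply: VY; apply: (embeds_trans YX); apply: (embeds_trans XZ).
  apply: (embeds_trans ZVF); apply: embeds_trans (embeds_square hi).
  apply: embeds_prod; first by exists id.
  apply: embeds_trans nV; exists pickle; exact: pcan_inj pickleK.
apply: nX; apply: (embeds_trans XZ); apply: (embeds_trans ZVF).
exists (fun t => pickle (f t.1, t.2)).
by move=> [x a] [y b] /(pcan_inj pickleK) [/fi -> ->].
Qed.

Lemma card_lt_option (V X : Type) :
  card_lt nat X -> card_lt V X -> card_lt (option V) X.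
Proof.
have optS Z : embeds nat Z -> embeds V Z -> embeds (option V) Z.
  move=> nZ VZ; have uZ : embeds unit Z.
    by have [h _] := nZ; exists (fun _ => h 0) => -[] [].
  have := embeds_sum nZ VZ uZ; apply: embeds_trans.
  by exists (fun o => if o is Some v then inl v else inr tt) => -[v|] [v'|] // [->].
move=> nX VX XV; have [nV|Vn] := embeds_total nat V.
  by apply: VX; apply: (embeds_trans XV); apply: optS => //; exists id.
by apply: nX; apply: (embeds_trans XV); apply: optS => //; exists id.
Qed.

(** * Closure properties of definable sets in arbitrary contexts *)

Section Definability.
Variables (L : language) (N : structure L).

(** [definable0] without finiteness of the context: parameters are named by variables, and there may
    be infinitely many of them. *)
Definition Dfn (V : Type) (ty : V -> lsort L) (X : env N ty -> Prop) : Prop :=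
  exists phi : formula ty, forall e, sat e phi <-> X e.

Definition dmap (V W : Type) (ty : V -> lsort L) (ty' : W -> lsort L)
    (t : env N ty -> env N ty') : Prop :=
  forall w, exists u : term ty (ty' w), forall e, eval e u = t e w.

Lemma Dfn_ext (V : Type) (ty : V -> lsort L) (X Y : env N ty -> Prop) :
  Dfn X -> (forall e, X e <-> Y e) -> Dfn Y.
Proof. by move=> [phi phiP] XY; exists phi => e; rewrite phiP. Qed.

Fixpoint tsubst (V W : Type) (ty : V -> lsort L) (ty' : W -> lsort L)
    (f : forall w, term ty (ty' w)) (s : lsort L) (t : term ty' s) : term ty s :=
  match t in term _ s return term ty s with
  | Var w => f w
  | App g args => App (fun i => tsubst f (args i))
  end.

Lemma eval_tsubst (V W : Type) (ty : V -> lsort L) (ty' : W -> lsort L)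
    (f : forall w, term ty (ty' w)) (e : env N ty) (s : lsort L) (t : term ty' s) :
  eval e (tsubst f t) = eval (fun w => eval e (f w)) t.
Proof.
elim: t => //= g args IH; congr fun_int.
by apply: functional_extensionality_dep => i.
Qed.

Lemma Dfn_False (V : Type) (ty : V -> lsort L) : Dfn (fun _ : env N ty => False).
Proof. by exists Bot. Qed.

Lemma Dfn_imp (V : Type) (ty : V -> lsort L) (X Y : env N ty -> Prop) :
  Dfn X -> Dfn Y -> Dfn (fun e => X e -> Y e).
Proof.
move=> [phi phiP] [psi psiP]; exists (Imp phi psi) => e /=.
by rewrite phiP psiP.
Qed.

Lemma Dfn_not (V : Type) (ty : V -> lsort L) (X : env N ty -> Prop) :
  Dfn X -> Dfn (fun e => ~ X e).
Proof. by move=> /Dfn_imp; apply; apply: Dfn_False. Qed.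

Lemma Dfn_True (V : Type) (ty : V -> lsort L) : Dfn (fun _ : env N ty => True).
Proof. by apply: (Dfn_ext (Dfn_not (@Dfn_False _ _))) => e; tauto. Qed.

Lemma Dfn_and (V : Type) (ty : V -> lsort L) (X Y : env N ty -> Prop) :
  Dfn X -> Dfn Y -> Dfn (fun e => X e /\ Y e).
Proof.
move=> dX dY; apply: (Dfn_ext (Dfn_not (Dfn_imp dX (Dfn_not dY)))) => e.
by have [xE|xE] := EM (X e); have [yE|yE] := EM (Y e); tauto.
Qed.

Lemma Dfn_or (V : Type) (ty : V -> lsort L) (X Y : env N ty -> Prop) :
  Dfn X -> Dfn Y -> Dfn (fun e => X e \/ Y e).
Proof.
move=> dX dY; apply: (Dfn_ext (Dfn_imp (Dfn_not dX) dY)) => e.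
by have [xE|xE] := EM (X e); tauto.
Qed.

Lemma Dfn_all1 (V : Type) (ty : V -> lsort L) (s : lsort L)
    (X : env N ty -> N s -> Prop) :
  Dfn (fun e : env N (ext_ty ty s) => X (fun v => e (Some v)) (e None)) ->
  Dfn (fun e => forall x, X e x).
Proof.
move=> [phi phiP]; exists (All phi) => e; split=> /= H x.
  exact: (phiP (ext_env e x)).1.
exact: (phiP (ext_env e x)).2 (H x).
Qed.

(** Induction on the formula for all [t] at once: under a quantifier [t] is extended by the bound
    variable, its old terms being weakened by a further substitution. *)
Lemma Dfn_subst (V W : Type) (ty : V -> lsort L) (ty' : W -> lsort L)
    (t : env N ty -> env N ty') (X : env N ty' -> Prop) :
  dmap t -> Dfn X -> Dfn (fun e => X (t e)).
Proof.
move=> dt [phi phiP].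
suff H : Dfn (fun e => sat (t e) phi) by apply: (Dfn_ext H) => e; apply: phiP.
move: {X phiP} phi => phi.
elim: phi V ty t dt => {W ty'} [W ty'|W ty' s a b|W ty' r args|W ty' phi IH psi IH'
  |W ty' s phi IH] V ty t /= dt.
- exact: Dfn_False.
- have [f fP] : exists f : forall w, term ty (ty' w), forall e w, eval e (f w) = t e w.
    exists (fun w => sval (cid (dt w))) => e w; exact: svalP (cid (dt w)) e.
  exists (Eq (tsubst f a) (tsubst f b)) => e /=; rewrite !eval_tsubst.
  by have -> : (fun w => eval e (f w)) = t e by apply: functional_extensionality_dep.
- have [f fP] : exists f : forall w, term ty (ty' w), forall e w, eval e (f w) = t e w.
    exists (fun w => sval (cid (dt w))) => e w; exact: svalP (cid (dt w)) e.
  exists (Rel (fun i => tsubst f (args i))) => e /=.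
  have <- : (fun w => eval e (f w)) = t e by apply: functional_extensionality_dep.
  set x := (fun i => _); set y := (fun i => _).
  by have -> : x = y by apply: functional_extensionality_dep => i; rewrite /x eval_tsubst.
- by apply: Dfn_imp; [apply: IH|apply: IH'].
- apply: Dfn_all1.
  apply: (IH _ (ext_ty ty s) (fun e : env N (ext_ty ty s) =>
     ext_env (t (fun v => e (Some v))) (e None))).
  move=> [w|] /=; last by exists (Var (ext_ty ty s) None).
  have [u uP] := dt w; exists (tsubst (fun v => Var (ext_ty ty s) (Some v)) u) => e.
  by rewrite eval_tsubst -uP.
Qed.

Lemma dmap_comp (V W Z : Type) (ty : V -> lsort L) (ty' : W -> lsort L)
    (tz : Z -> lsort L) (t : env N ty -> env N ty') (u : env N ty' -> env N tz) :
  dmap t -> dmap u -> dmap (fun e => u (t e)).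
Proof.
move=> dt du z; have [a aP] := du z.
exists (tsubst (fun w => sval (cid (dt w))) a) => e; rewrite eval_tsubst -aP.
rewrite (_ : (fun w => _) = t e) //; apply: functional_extensionality_dep => w.
exact: svalP (cid (dt w)) e.
Qed.

Lemma dmap_sum (V W Z : Type) (ty : V -> lsort L) (ty' : W -> lsort L)
    (tz : Z -> lsort L) (t : env N ty -> env N ty') (u : env N ty -> env N tz) :
  dmap t -> dmap u -> dmap (fun e => sum_env (t e) (u e)).
Proof. by move=> dt du [w|z]; [apply: dt|apply: du]. Qed.

Lemma sum_env_eta (V W : Type) (ty : V -> lsort L) (ty' : W -> lsort L)
    (e : env N (sum_ty ty ty')) : sum_env (envl e) (envr e) = e.
Proof. by apply: functional_extensionality_dep => -[v|w]. Qed.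

Lemma dmap_envl (V W : Type) (ty : V -> lsort L) (ty' : W -> lsort L) :
  dmap (fun e : env N (sum_ty ty ty') => envl e).
Proof. by move=> v; exists (Var (sum_ty ty ty') (inl v)). Qed.

Lemma dmap_envr (V W : Type) (ty : V -> lsort L) (ty' : W -> lsort L) :
  dmap (fun e : env N (sum_ty ty ty') => envr e).
Proof. by move=> v; exists (Var (sum_ty ty ty') (inr v)). Qed.

Lemma Dfn_eq (V : Type) (ty : V -> lsort L) (s : lsort L) (a b : env N ty -> N s) :
  (exists u : term ty s, forall e, eval e u = a e) ->
  (exists u : term ty s, forall e, eval e u = b e) ->
  Dfn (fun e => a e = b e).
Proof. by move=> [u uP] [v vP]; exists (Eq u v) => e /=; rewrite uP vP. Qed.

Lemma Dfn_all_list (V J : Type) (ty : V -> lsort L) (l : seq J)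
    (X : J -> env N ty -> Prop) :
  (forall j, Dfn (X j)) -> Dfn (fun e => forall j, List.In j l -> X j e).
Proof.
move=> dX; elim: l => [|j l IH]; first by apply: (Dfn_ext (@Dfn_True _ _)).
apply: (Dfn_ext (Dfn_and (dX j) IH)) => e; split=> [[h1 h2] k [<-|/h2]|h] //.
by split=> [|k kl]; apply: h; [left|right].
Qed.

Lemma In_mem (T : eqType) (x : T) (l : seq T) : x \in l -> List.In x l.
Proof. by elim: l => //= y l IH; rewrite inE => /orP[/eqP->|/IH]; [left|right]. Qed.

Lemma Dfn_all_fin (V : Type) (J : finType) (ty : V -> lsort L)
    (X : J -> env N ty -> Prop) :
  (forall j, Dfn (X j)) -> Dfn (fun e => forall j, X j e).
Proof.
move=> dX; apply: (Dfn_ext (Dfn_all_list (enum J) dX)) => e.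
by split=> H j //; apply: H; apply: In_mem; rewrite mem_enum.
Qed.

(** Formulas bind one variable at a time, so quantification over a [W]-tuple is obtained by
    induction on the size of [W]: the empty type, adding one point, and transport along a
    bijection. *)
Definition all_env_closed (W : Type) : Prop :=
  forall (ty' : W -> lsort L) (V : Type) (ty : V -> lsort L)
    (X : env N ty -> env N ty' -> Prop),
    Dfn (fun e : env N (sum_ty ty ty') => X (envl e) (envr e)) ->
    Dfn (fun e => forall x, X e x).

Lemma all_env_empty (W : Type) : (W -> False) -> all_env_closed W.
Proof.
move=> W0 ty' V ty X dX; pose e0 : env N ty' := fun w => False_rect _ (W0 w).
have d : dmap (fun e : env N ty => sum_env e e0).
  by move=> [v|w]; [exists (Var ty v)|case: (W0 w)].
apply: (Dfn_ext (Dfn_subst d dX)) => e; split=> [H x|]; last exact.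
rewrite (_ : x = e0) //; apply: functional_extensionality_dep => w; case: (W0 w).
Qed.

Lemma all_env_option (W : Type) : all_env_closed W -> all_env_closed (option W).
Proof.
move=> IH ty' V ty X dX.
pose ty1 : W -> lsort L := fun w => ty' (Some w).
pose mk (e : env N ty1) (x : N (ty' None)) : env N ty' :=
  fun o => match o return N (ty' o) with Some w => e w | None => x end.
have H : Dfn (fun e => forall (x : N (ty' None)) (y : env N ty1), X e (mk y x)).
  apply: Dfn_all1; apply: IH.
  have d : dmap (fun e : env N (sum_ty (ext_ty ty (ty' None)) ty1) =>
      sum_env (ty' := ty') (fun v => e (inl (Some v)))
        (mk (fun w => e (inr w)) (e (inl None)))).
    move=> [v|[w|]].
    - by exists (Var (sum_ty (ext_ty ty (ty' None)) ty1) (inl (Some v))).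
    - by exists (Var (sum_ty (ext_ty ty (ty' None)) ty1) (inr w)).
    - by exists (Var (sum_ty (ext_ty ty (ty' None)) ty1) (inl None)).
  by apply: (Dfn_ext (Dfn_subst d dX)) => e.
apply: (Dfn_ext H) => e; split=> [h x|]; last by auto.
rewrite (_ : x = mk (fun w => x (Some w)) (x None)) //.
by apply: functional_extensionality_dep => -[w|].
Qed.

Lemma all_env_bij (W Z : Type) (f : W -> Z) (g : Z -> W) :
  cancel f g -> cancel g f -> all_env_closed Z -> all_env_closed W.
Proof.
move=> fK gK IH ty' V ty X dX.
pose ty1 z := ty' (g z).
pose mk (e : env N ty1) : env N ty' :=
  fun w => eq_rect _ (fun w => N (ty' w)) (e (f w)) _ (fK w).
have H : Dfn (fun e => forall y : env N ty1, X e (mk y)).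
  apply: IH; have d : dmap (fun e : env N (sum_ty ty ty1) =>
      sum_env (ty' := ty') (envl e) (mk (envr e))).
    apply: dmap_sum; first exact: dmap_envl.
    move=> w; rewrite /mk; move: (f w) (fK w) => z; case: _ /; exact: dmap_envr.
  exact: (Dfn_ext (Dfn_subst d dX)).
apply: (Dfn_ext H) => e; split=> [h x|]; last by auto.
rewrite (_ : x = mk (fun z => x (g z))) //; apply: functional_extensionality_dep => w.
by rewrite /mk; move: (f w) (fK w) => z; case: _ /.
Qed.

Lemma all_env_fin (W : finType) : all_env_closed W.
Proof.
apply: (@all_env_bij W 'I_#|W| enum_rank enum_val (@enum_rankK W) (@enum_valK W)).
elim: #|W| => [|n IH]; first by apply: all_env_empty; case.
apply: (@all_env_bij _ (option 'I_n) (unlift ord0) (odflt ord0 \o omap (lift ord0))).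
- by move=> i; case: unliftP => [j ->|->].
- by move=> [j|] /=; rewrite ?liftK ?unlift_none.
exact: all_env_option.
Qed.

Lemma Dfn_all (W : finType) (ty' : W -> lsort L) (V : Type) (ty : V -> lsort L)
    (X : env N ty -> env N ty' -> Prop) :
  Dfn (fun e : env N (sum_ty ty ty') => X (envl e) (envr e)) ->
  Dfn (fun e => forall x, X e x).
Proof. exact: all_env_fin. Qed.

Lemma Dfn_ex (W : finType) (ty' : W -> lsort L) (V : Type) (ty : V -> lsort L)
    (X : env N ty -> env N ty' -> Prop) :
  Dfn (fun e : env N (sum_ty ty ty') => X (envl e) (envr e)) ->
  Dfn (fun e => exists x, X e x).
Proof.
move=> /Dfn_not dX.
apply: (Dfn_ext (Dfn_not (@Dfn_all _ _ _ _ (fun e x => ~ X e x) dX))) => e.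
by split=> [/existsNP[x /contrapT]|[x Xx]]; [exists x|move/(_ x)].
Qed.

(** The variables of [W] are replaced by the parameters that name their values under [e0]. *)
Lemma definable_of_Dfn (V : finType) (W : Type) (ty : V -> lsort L)
    (ty' : W -> lsort L) (e0 : env N ty') (X : env N (sum_ty ty ty') -> Prop) :
  Dfn X -> definable (fun e => X (sum_env e e0)).
Proof.
move=> dX; pose tE := @elt_ty L N (fun _ => True).
pose par (w : W) : {b : elt N | True} := exist _ (existT _ (ty' w) (e0 w)) I.
have d : dmap (fun e : env N (sum_ty ty tE) =>
    sum_env (ty' := ty') (envl e) (fun w => e (inr (par w)))).
  by move=> [v|w]; [exists (Var (sum_ty ty tE) (inl v))
                   |exists (Var (sum_ty ty tE) (inr (par w)))].
by have [phi phiP] := Dfn_subst d dX; exists phi => e; rewrite phiP.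
Qed.

(** * Saturation for tuples and for families of definable conditions *)

Section Saturation.
Hypotheses (satN : saturated N) (nN : card_lt nat (elt N)).

(** Bridges two views of parameters: [saturated] uses a set [B] of elements, here they are the
    values of an environment. There are no more values than variables, and conditions are
    substituted along the naming of the values. *)
Lemma realize1 (V J : Type) (ty : V -> lsort L) (e : env N ty) (s : lsort L)
    (X : J -> env N ty -> N s -> Prop) :
  card_lt V (elt N) ->
  (forall j, Dfn (fun e : env N (ext_ty ty s) => X j (fun v => e (Some v)) (e None))) ->
  (forall l, exists x, forall j, List.In j l -> X j e x) ->
  exists x, forall j, X j e x.
Proof.
move=> Vlt dX fin.
pose par v : elt N := existT _ (ty v) (e v); pose B b := exists v, par v = b.
have Blt : card_lt {b | B b} (elt N).
  move=> NB; apply: Vlt; apply: (embeds_trans NB).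
  apply: (embeds_surj (f := fun v => exist B (par v) (ex_intro _ v erefl))).
  by move=> [b bB]; have [v vb] := bB; exists v; subst b; congr exist.
pose tB := ext_ty (@elt_ty L N B) s.
pose t (e' : env N tB) : env N (ext_ty ty s) := ext_env
  (fun v => e' (Some (exist B (par v) (ex_intro _ v erefl)))) (e' None).
have dt : dmap t.
  by move=> [v|]; [exists (Var tB (Some (exist B (par v) (ex_intro _ v erefl))))
                  |exists (Var tB None)].
have /choice [phi phiP] j := Dfn_subst dt (dX j).
have [l lphi|x xP] := satN Blt (p := fun f => exists j, f = phi j).
  have [k kP] : exists k, forall f, List.In f l -> exists2 j, List.In j k & f = phi j.
    elim: l lphi => [|f l IH] lphi; first by exists [::].
    have [|k kP] := IH; first by move=> g gl; apply: lphi; right.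
    have [j ->] := lphi f (or_introl erefl).
    exists (j :: k) => g [<-|/kP [j' j'k ->]]; first by exists j => //; left.
    by exists j' => //; right.
  have [x xP] := fin k; exists x => f /kP [j jk ->]; apply/phiP.
  exact: xP jk.
by exists x => j; have /phiP := xP _ (ex_intro _ j erefl).
Qed.

Definition tuple_realizing (W : Type) : Prop :=
  forall (ty' : W -> lsort L) (V J : Type) (ty : V -> lsort L) (e : env N ty)
    (X : J -> env N ty -> env N ty' -> Prop), card_lt V (elt N) ->
  (forall j, Dfn (fun e : env N (sum_ty ty ty') => X j (envl e) (envr e))) ->
  (forall l, exists x, forall j, List.In j l -> X j e x) ->
  exists x, forall j, X j e x.

(** The first coordinate is chosen so that every finite list of conditions can still be met by the
    remaining ones; its type is therefore indexed by [seq J]. It then joins the parameters, in the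
    context [option V], which is still small. *)
Lemma tuple_realizing_option (W : finType) :
  tuple_realizing W -> tuple_realizing (option W).
Proof.
move=> IH ty' V J ty e X Vlt dX fin.
pose ty1 : W -> lsort L := fun w => ty' (Some w).
pose mk (x : N (ty' None)) (y : env N ty1) : env N ty' :=
  fun o => match o return N (ty' o) with Some w => y w | None => x end.
have mkE (y : env N ty') : y = mk (y None) (fun w => y (Some w)).
  by apply: functional_extensionality_dep => -[].
have dX' j : Dfn (fun e : env N (sum_ty (ext_ty ty (ty' None)) ty1) =>
    X j (fun v => envl e (Some v)) (mk (envl e None) (envr e))).
  have d : dmap (fun e : env N (sum_ty (ext_ty ty (ty' None)) ty1) =>
      sum_env (ty' := ty') (fun v => e (inl (Some v)))
        (mk (e (inl None)) (fun w => e (inr w)))).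
    move=> [v|[w|]].
    - by exists (Var (sum_ty (ext_ty ty (ty' None)) ty1) (inl (Some v))).
    - by exists (Var (sum_ty (ext_ty ty (ty' None)) ty1) (inr w)).
    - by exists (Var (sum_ty (ext_ty ty (ty' None)) ty1) (inl None)).
  by apply: (Dfn_ext (Dfn_subst d (dX j))) => e'.
have [l||x xP] := @realize1 V (seq J) ty e (ty' None)
  (fun l e x => exists y, forall j, List.In j l -> X j e (mk x y)) Vlt.
- apply: Dfn_ex; exact: Dfn_all_list.
- move=> ls; have [y yP] := fin (flatten ls); exists (y None) => l lls.
  exists (fun w => y (Some w)) => j jl; rewrite -mkE; apply: yP.
  elim: ls lls => //= l' ls IHl [->|/IHl h]; apply/List.in_or_app; first by left.
  by right.
have [|||y yP] := @IH ty1 (option V) J (ext_ty ty (ty' None)) (ext_env e x)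
  (fun j e y => X j (fun v => e (Some v)) (mk (e None) y)).
- exact: card_lt_option.
- exact: dX'.
- exact: xP.
by exists (mk x y).
Qed.

Lemma realize (W : finType) : tuple_realizing W.
Proof.
have bij (Z Z' : Type) (f : Z -> Z') (g : Z' -> Z) : cancel f g -> cancel g f ->
    tuple_realizing Z' -> tuple_realizing Z.
  move=> fK gK IH ty' V J ty e X Vlt dX fin; pose ty1 z := ty' (g z).
  pose mk (e : env N ty1) : env N ty' :=
    fun w => eq_rect _ (fun w => N (ty' w)) (e (f w)) _ (fK w).
  have mkE y : y = mk (fun z => y (g z)).
    by apply: functional_extensionality_dep => w; rewrite /mk; move: (f w) (fK w) => z; case: _ /.
  have [|j|l|y yP] := IH ty1 V J ty e (fun j e y => X j e (mk y)).
  - exact: Vlt.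
  - have d : dmap (fun e : env N (sum_ty ty ty1) =>
      sum_env (ty' := ty') (envl e) (mk (envr e))).
      apply: dmap_sum; first exact: dmap_envl.
      move=> w; rewrite /mk; move: (f w) (fK w) => z; case: _ /; exact: dmap_envr.
    exact: (Dfn_ext (Dfn_subst d (dX j))).
  - have [y yP] := fin l; exists (fun z => y (g z)) => j; rewrite -mkE; exact: yP.
  by exists (mk y).
apply: (@bij W 'I_#|W| enum_rank enum_val (@enum_rankK W) (@enum_valK W)).
elim: #|W| => [|n IH].
  move=> ty' V J ty e X Vlt dX fin.
  have [x _] := fin [::]; exists x => j; have [y /(_ j)] := fin [:: j].
  rewrite (_ : y = x); first by apply; left.
  by apply: functional_extensionality_dep; case.
apply: (bij _ (option 'I_n) (unlift ord0) (odflt ord0 \o omap (lift ord0))).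
- by move=> i; case: unliftP => [j ->|->].
- by move=> [j|] /=; rewrite ?liftK ?unlift_none.
exact: tuple_realizing_option.
Qed.

End Saturation.
End Definability.

(** * Definability on sets presented by codings *)

Section Codings.
Variables (L : language) (N : structure L).

(* Only the behaviour on tuples that code something is prescribed, which makes
   this notion closed under complements without intersecting with the domain. *)
Definition zd (X : Type) (c : coding N X) (P : X -> Prop) : Prop :=
  exists2 D : env N (cty c) -> Prop, Dfn D &
    forall e x, code c e x -> (D e <-> P x).

(** Stronger than a definable graph: terms compute [f] on codes, so that predicates pull back along
    [f] without a quantifier. *)
Definition tracked (X Y : Type) (c : coding N X) (d : coding N Y) (f : X -> Y) :
    Prop :=
  exists2 t : env N (cty c) -> env N (cty d), dmap t &
    forall e x, code c e x -> code d (t e) (f x).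

Lemma zdef_of_zd (X : Type) (c : coding N X) (P : X -> Prop) :
  (forall e x y, code c e x -> code c e y -> x = y) ->
  Dfn (fun e : env N (cty c) => exists x, code c e x) ->
  zd c P -> zdef_set c P.
Proof.
move=> cf cd [D dD DP]; apply: (Dfn_ext (Dfn_and cd dD)) => e; split.
  by move=> [[x cx] De]; exists x => //; apply/(DP e).
by move=> [x cx Px]; split; [exists x|apply/(DP e x)].
Qed.

Lemma zd_of_zdef (X : Type) (c : coding N X) (P : X -> Prop) :
  imaginary_set c -> zdef_set c P -> zd c P.
Proof.
move=> [cf _ _ _] dP; exists (fun e => exists2 x, code c e x & P x) => // e x cx.
by split=> [[y cy]|Px]; [rewrite (cf _ _ _ cx cy)|exists x].
Qed.

Lemma imaginary_dom (X : Type) (c : coding N X) : imaginary_set c ->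
  Dfn (fun e : env N (cty c) => exists x, code c e x).
Proof. by move=> [_ _ cd _]; apply: (Dfn_ext cd) => e; split=> [[x]|[x]]; exists x. Qed.

Lemma zd_ext (X : Type) (c : coding N X) (P Q : X -> Prop) :
  zd c P -> (forall x, P x <-> Q x) -> zd c Q.
Proof. by move=> [D dD DP] PQ; exists D => // e x /DP ->. Qed.

Lemma zd_imp (X : Type) (c : coding N X) (P Q : X -> Prop) :
  zd c P -> zd c Q -> zd c (fun x => P x -> Q x).
Proof.
move=> [D dD DP] [E dE EQ]; exists (fun e => D e -> E e); first exact: Dfn_imp.
by move=> e x cx; rewrite (DP _ _ cx) (EQ _ _ cx).
Qed.

Lemma zd_False (X : Type) (c : coding N X) : zd c (fun _ => False).
Proof. by exists (fun _ => False) => //; apply: Dfn_False. Qed.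

Lemma zd_not (X : Type) (c : coding N X) (P : X -> Prop) :
  zd c P -> zd c (fun x => ~ P x).
Proof. by move=> dP; apply: zd_imp => //; apply: zd_False. Qed.

Lemma zd_and (X : Type) (c : coding N X) (P Q : X -> Prop) :
  zd c P -> zd c Q -> zd c (fun x => P x /\ Q x).
Proof.
move=> [D dD DP] [E dE EQ]; exists (fun e => D e /\ E e); first exact: Dfn_and.
by move=> e x cx; rewrite (DP _ _ cx) (EQ _ _ cx).
Qed.

Lemma zd_or (X : Type) (c : coding N X) (P Q : X -> Prop) :
  zd c P -> zd c Q -> zd c (fun x => P x \/ Q x).
Proof.
move=> [D dD DP] [E dE EQ]; exists (fun e => D e \/ E e); first exact: Dfn_or.
by move=> e x cx; rewrite (DP _ _ cx) (EQ _ _ cx).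
Qed.

Lemma zd_iff (X : Type) (c : coding N X) (P Q : X -> Prop) :
  zd c P -> zd c Q -> zd c (fun x => P x <-> Q x).
Proof. by move=> dP dQ; apply: zd_and; apply: zd_imp. Qed.

Lemma zd_all_fin (J : finType) (X : Type) (c : coding N X) (P : J -> X -> Prop) :
  (forall j, zd c (P j)) -> zd c (fun x => forall j, P j x).
Proof.
move=> dP; have /choice [D DP] j : exists D : env N (cty c) -> Prop, Dfn D /\
    forall e x, code c e x -> (D e <-> P j x) by have [D] := dP j; exists D.
exists (fun e => forall j, D j e); first by apply: Dfn_all_fin => j; case: (DP j).
by move=> e x cx; split=> H j; have := H j; case: (DP j) => _ /(_ _ _ cx) [].
Qed.

Lemma zd_pull (X Y : Type) (c : coding N X) (d : coding N Y) (f : X -> Y)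
    (P : Y -> Prop) : zd d P -> tracked c d f -> zd c (fun x => P (f x)).
Proof.
move=> [D dD DP] [t dt tP]; exists (fun e => D (t e)); first exact: Dfn_subst.
by move=> e x /tP /DP.
Qed.

Lemma tracked_id (X : Type) (c : coding N X) : tracked c c id.
Proof. by exists id => // v; exists (Var (cty c) v). Qed.

Lemma tracked_comp (X Y Z : Type) (c : coding N X) (d : coding N Y)
    (b : coding N Z) (f : X -> Y) (g : Y -> Z) :
  tracked d b g -> tracked c d f -> tracked c b (fun x => g (f x)).
Proof.
move=> [t dt tP] [u du uP]; exists (fun e => t (u e)); first exact: dmap_comp.
by move=> e x /uP /tP.
Qed.

Lemma tracked_fst (Z X Y : Type) (b : coding N Z) (c : coding N X) (d : coding N Y)
    (f : Z -> X * Y) :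
  tracked b (prod_coding c d) f -> tracked b c (fun z => (f z).1).
Proof.
apply: tracked_comp; exists (@envl _ _ _ _ _ _); first exact: dmap_envl.
by move=> e x [].
Qed.

Lemma tracked_snd (Z X Y : Type) (b : coding N Z) (c : coding N X) (d : coding N Y)
    (f : Z -> X * Y) :
  tracked b (prod_coding c d) f -> tracked b d (fun z => (f z).2).
Proof.
apply: tracked_comp; exists (@envr _ _ _ _ _ _); first exact: dmap_envr.
by move=> e x [].
Qed.

Lemma tracked_pair (Z X Y : Type) (b : coding N Z) (c : coding N X) (d : coding N Y)
    (f : Z -> X) (g : Z -> Y) : tracked b c f -> tracked b d g ->
  tracked b (prod_coding c d) (fun z => (f z, g z)).
Proof.
move=> [t dt tP] [u du uP]; exists (fun e => sum_env (t e) (u e)).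
  exact: dmap_sum.
by move=> e z cz; split; [apply: tP|apply: uP].
Qed.

Definition pow_coding (J : finType) (X : Type) (c : coding N X) :
    coding N (J -> X) :=
  @Coding L N (J -> X) (J * cvar c)%type (fun jw => cty c jw.2)
    (fun e x => forall j, code c (fun w => e (j, w)) (x j)).

Lemma tracked_proj (J : finType) (Z X : Type) (b : coding N Z) (c : coding N X)
    (f : Z -> J -> X) (j : J) :
  tracked b (pow_coding J c) f -> tracked b c (fun z => f z j).
Proof.
apply: (@tracked_comp _ _ _ b (pow_coding J c) c f (fun g => g j)).
exists (fun e w => e (j, w)) => [|e x /(_ j)] //.
by move=> w; exists (Var (cty (pow_coding J c)) (j, w)).
Qed.

Lemma tracked_tuple (J : finType) (Z X : Type) (b : coding N Z) (c : coding N X)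
    (f : Z -> J -> X) :
  (forall j, tracked b c (fun z => f z j)) -> tracked b (pow_coding J c) f.
Proof.
move=> tf; have /choice [t tP] j : exists t, @dmap _ N _ _ (cty b) (cty c) t /\
    forall e x, code b e x -> code c (t e) (f x j).
  by have [t] := tf j; exists t.
exists (fun e jw => t jw.1 e jw.2); first by move=> [j w]; case: (tP j) => /(_ w).
by move=> e z cz j; case: (tP j) => _; apply.
Qed.

(** The quantifier over [Y] becomes one over tuples, relativised to those that code something; every
    element of [Y] is reached because the coding is surjective. *)
Lemma zd_all (X Y : Type) (c : coding N X) (d : coding N Y) (P : X -> Y -> Prop) :
  imaginary_set d -> zd (prod_coding c d) (fun t => P t.1 t.2) ->
  zd c (fun x => forall y, P x y).
Proof.
move=> id [D dD DP]; have [_ ds _ _] := id.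
exists (fun e => forall e', (exists y, code d e' y) -> D (sum_env e e')).
  apply: Dfn_all; apply: Dfn_imp.
    exact: Dfn_subst (@dmap_envr _ _ _ _ _ _) (imaginary_dom id).
  by apply: (Dfn_ext dD) => e; rewrite sum_env_eta.
move=> e x cx; split=> [H y|H e' [y cy]].
  have [e' cy] := ds y; apply/(DP (sum_env e e') (x, y)); first by split.
  by apply: H; exists y.
exact/(DP (sum_env e e') (x, y)).
Qed.

Lemma zd_ex (X Y : Type) (c : coding N X) (d : coding N Y) (P : X -> Y -> Prop) :
  imaginary_set d -> zd (prod_coding c d) (fun t => P t.1 t.2) ->
  zd c (fun x => exists y, P x y).
Proof.
move=> id /zd_not dP; apply: (zd_ext (zd_not (zd_all (P := fun x y => ~ P x y) id dP))).
by move=> x; split=> [/existsNP[y /contrapT]|[y Py]]; [exists y|move/(_ y)].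
Qed.

Lemma zd_eq (X : Type) (c : coding N X) : imaginary_set c ->
  zd (prod_coding c c) (fun t => t.1 = t.2).
Proof.
move=> ic; have [cf _ _ ck] := ic.
exists (fun e => exists2 t, code (prod_coding c c) e t & t.1 = t.2) => //.
move=> e [x y] [/= cx cy]; split=> [[[x' y'] [/= cx' cy']]|xy]; last by exists (x, y).
by rewrite (cf _ _ _ cx cx') (cf _ _ _ cy cy').
Qed.

Lemma zd_eq2 (Z X : Type) (b : coding N Z) (c : coding N X) (f g : Z -> X) :
  imaginary_set c -> tracked b c f -> tracked b c g -> zd b (fun z => f z = g z).
Proof.
move=> ic tf tg; apply: (@zd_pull _ _ b _ (fun z => (f z, g z)) _ (zd_eq ic)).
exact: tracked_pair.
Qed.

Lemma zd_swap (Z Z' : Type) (b : coding N Z) (b' : coding N Z')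
    (P : Z * Z' -> Prop) :
  zd (prod_coding b' b) (fun t => P (t.2, t.1)) -> zd (prod_coding b b') P.
Proof.
move=> dP; have := @zd_pull _ _ (prod_coding b b') _ (fun t => (t.2, t.1)) _ dP.
move=> H; apply: (zd_ext (H _)) => [|[] //].
by apply: tracked_pair; [apply: tracked_snd|apply: tracked_fst]; apply: tracked_id.
Qed.

Lemma prod_code_fun (X Y : Type) (c : coding N X) (d : coding N Y) :
  imaginary_set c -> imaginary_set d ->
  forall e x y, code (prod_coding c d) e x -> code (prod_coding c d) e y -> x = y.
Proof.
move=> [cf _ _ _] [df _ _ _] e [x y] [x' y'] [/= cx cy] [/= cx' cy'].
by rewrite (cf _ _ _ cx cx') (df _ _ _ cy cy').
Qed.

Lemma prod_code_dom (X Y : Type) (c : coding N X) (d : coding N Y) :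
  Dfn (fun e : env N (cty c) => exists x, code c e x) ->
  Dfn (fun e : env N (cty d) => exists x, code d e x) ->
  Dfn (fun e : env N (cty (prod_coding c d)) => exists x, code (prod_coding c d) e x).
Proof.
move=> cd dd.
have H := Dfn_and (Dfn_subst (@dmap_envl _ _ _ _ (cty c) (cty d)) cd)
                  (Dfn_subst (@dmap_envr _ _ _ _ (cty c) (cty d)) dd).
apply: (Dfn_ext H) => e; split=> [[[x cx] [y cy]]|[[x y] [cx cy]]].
  by exists (x, y).
by split; [exists x|exists y].
Qed.

Lemma imaginary_intro (X : Type) (c : coding N X) :
  (forall e x y, code c e x -> code c e y -> x = y) ->
  (forall x, exists e, code c e x) ->
  Dfn (fun e : env N (cty c) => exists x, code c e x) ->
  zd (prod_coding c c) (fun t => t.1 = t.2) -> imaginary_set c.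
Proof.
move=> cf cs cd ck; split=> //.
  by apply: (Dfn_ext cd) => e; split=> [[x]|[x]]; exists x.
apply: zdef_of_zd ck; last exact: prod_code_dom.
move=> e [x y] [x' y'] [/= cx cy] [/= cx' cy'].
by rewrite (cf _ _ _ cx cx') (cf _ _ _ cy cy').
Qed.

Lemma imaginary_prod (X Y : Type) (c : coding N X) (d : coding N Y) :
  imaginary_set c -> imaginary_set d -> imaginary_set (prod_coding c d).
Proof.
move=> ic id; have [cf cs _ _] := ic; have [df ds _ _] := id.
apply: imaginary_intro; first exact: prod_code_fun.
- move=> [x y]; have [e ce] := cs x; have [e' ce'] := ds y.
  by exists (sum_env e e').
- by apply: prod_code_dom; apply: imaginary_dom.
apply: (@zd_ext _ _ (fun t => t.1.1 = t.2.1 /\ t.1.2 = t.2.2)); last first.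
  by move=> [[x y] [x' y']] /=; split=> [[-> ->]|[-> ->]].
have t1 := tracked_fst (tracked_id (prod_coding (prod_coding c d) (prod_coding c d))).
have t2 := tracked_snd (tracked_id (prod_coding (prod_coding c d) (prod_coding c d))).
apply: zd_and.
  by apply: (@zd_eq2 _ _ _ c) => //; [apply: tracked_fst t1|apply: tracked_fst t2].
by apply: (@zd_eq2 _ _ _ d) => //; [apply: tracked_snd t1|apply: tracked_snd t2].
Qed.

Lemma imaginary_pow (J : finType) (X : Type) (c : coding N X) :
  imaginary_set c -> imaginary_set (pow_coding J c).
Proof.
move=> ic; have [cf cs _ _] := ic; apply: imaginary_intro.
- by move=> e x y cx cy; apply: funext => j; apply: cf (cx j) (cy j).
- move=> x; have /choice [e eP] j := cs (x j).
  by exists (fun jw => e jw.1 jw.2).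
- have H j : Dfn (fun e : env N (cty (pow_coding J c)) =>
      exists x, code c (fun w => e (j, w)) x).
    apply: (Dfn_subst (t := fun (e : env N (cty (pow_coding J c))) w => e (j, w))
      _ (imaginary_dom ic)).
    by move=> w; exists (Var (cty (pow_coding J c)) (j, w)).
  by apply: (Dfn_ext (Dfn_all_fin H)) => e; split=> [/choice [x xP]|[x cx] j];
    [exists x|exists (x j)].
apply: (@zd_ext _ _ (fun t => forall j, t.1 j = t.2 j)); last first.
  by move=> [x y] /=; split=> [/funext|->].
apply: zd_all_fin => j; apply: (@zd_eq2 _ _ _ c) => //; apply: tracked_proj.
  exact: tracked_fst (tracked_id _).
exact: tracked_snd (tracked_id _).
Qed.

Definition zfun (X Y : Type) (c : coding N X) (d : coding N Y) (f : X -> Y) : Prop :=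
  zd (prod_coding c d) (fun t => t.2 = f t.1).

Lemma zfun_tracked (X Y : Type) (c : coding N X) (d : coding N Y) (f : X -> Y) :
  imaginary_set d -> tracked c d f -> zfun c d f.
Proof.
move=> id tf; apply: (@zd_eq2 _ _ _ d (fun t => t.2) (fun t => f t.1)) => //.
  exact: tracked_snd (tracked_id _).
exact: tracked_comp tf (tracked_fst (tracked_id _)).
Qed.

Lemma zfun_comp (X Y Z : Type) (c : coding N X) (d : coding N Y) (b : coding N Z)
    (f : X -> Y) (g : Y -> Z) :
  imaginary_set d -> zfun d b g -> zfun c d f -> zfun c b (fun x => g (f x)).
Proof.
move=> id zg zf; set t := prod_coding c b.
have t1 : tracked t c (fun x => x.1) := tracked_fst (tracked_id _).
have t2 : tracked t b (fun x => x.2) := tracked_snd (tracked_id _).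
apply: (@zd_ext _ _ (fun x => exists y, y = f x.1 /\ x.2 = g y)); last first.
  by move=> x; split=> [[y [->]]|xE]; [|exists (f x.1)].
apply: (zd_ex (P := fun x y => y = f x.1 /\ x.2 = g y) id).
have s1 : tracked (prod_coding t d) t (fun x => x.1) := tracked_fst (tracked_id _).
have s2 : tracked (prod_coding t d) d (fun x => x.2) := tracked_snd (tracked_id _).
apply: zd_and.
  exact: (@zd_pull _ _ _ _ (fun x => (x.1.1, x.2)) _ zf
    (tracked_pair (tracked_comp t1 s1) s2)).
exact: (@zd_pull _ _ _ _ (fun x => (x.2, x.1.2)) _ zg
    (tracked_pair s2 (tracked_comp t2 s1))).
Qed.

Lemma zfun_eq (Z X : Type) (b : coding N Z) (c : coding N X) (f g : Z -> X) :
  imaginary_set c -> zfun b c f -> zfun b c g -> zd b (fun z => f z = g z).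
Proof.
move=> ic zf zg; apply: (@zd_ext _ _ (fun z => exists x, x = f z /\ x = g z)).
  by apply: (zd_ex (P := fun z x => x = f z /\ x = g z) ic); apply: zd_and.
by move=> z; split=> [[x [<-]]|fg]; [|exists (f z)].
Qed.

Lemma zdef_fun_of_zfun (X Y : Type) (c : coding N X) (d : coding N Y) (f : X -> Y) :
  imaginary_set c -> imaginary_set d -> zfun c d f -> zdef_fun c d f.
Proof.
move=> ic id; apply: zdef_of_zd; first exact: prod_code_fun.
by apply: prod_code_dom; apply: imaginary_dom.
Qed.

(** * Disjoint unions *)

Section Sum.
Variables (s : lsort L) (b0 b1 : N s).
Hypothesis b01 : b0 <> b1.

(* Two extra coordinates in a sort with two elements distinguish the summands:
   they agree for [inl] and differ for [inr]. *)
Definition sum_coding (X Y : Type) (c : coding N X) (d : coding N Y) :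
    coding N (X + Y) :=
  @Coding L N (X + Y) ((cvar c + cvar d) + bool)%type
    (sum_ty (sum_ty (cty c) (cty d)) (fun _ : bool => s))
    (fun e z => match z with
      | inl x => envr e true = envr e false /\ code c (envl (envl e)) x
      | inr y => envr e true <> envr e false /\ code d (envr (envl e)) y
      end).

Variables (X Y : Type) (c : coding N X) (d : coding N Y).

Let tag (e : env N (cty (sum_coding c d))) := envr e true = envr e false.

Let dtag : Dfn tag.
Proof.
pose ty := cty (sum_coding c d).
by apply: Dfn_eq; [exists (Var ty (inr true))|exists (Var ty (inr false))].
Qed.

Let dl : @dmap _ N _ _ (cty (sum_coding c d)) (cty c) (fun e => envl (envl e)).
Proof. exact: dmap_comp (@dmap_envl _ _ _ _ _ _) (@dmap_envl _ _ _ _ _ _). Qed.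

Let dr : @dmap _ N _ _ (cty (sum_coding c d)) (cty d) (fun e => envr (envl e)).
Proof. exact: dmap_comp (@dmap_envl _ _ _ _ _ _) (@dmap_envr _ _ _ _ _ _). Qed.

Lemma zd_case (Z : Type) (b : coding N Z) (P : Z * (X + Y) -> Prop) :
  zd (prod_coding b c) (fun t => P (t.1, inl t.2)) ->
  zd (prod_coding b d) (fun t => P (t.1, inr t.2)) ->
  zd (prod_coding b (sum_coding c d)) P.
Proof.
move=> [D dD DP] [E dE EP].
pose B := cty (prod_coding b (sum_coding c d)).
have dbl : @dmap _ N _ _ B (cty b) (fun e => envl e) by apply: dmap_envl.
have dbr : @dmap _ N _ _ B (cty (sum_coding c d)) (fun e => envr e).
  exact: dmap_envr.
exists (fun e : env N B => (tag (envr e) -> D (sum_env (envl e) (envl (envl (envr e))))) /\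
  (~ tag (envr e) -> E (sum_env (envl e) (envr (envl (envr e)))))).
  have dt := Dfn_subst dbr dtag; apply: Dfn_and; apply: Dfn_imp => //.
  - by apply: Dfn_subst dD; apply: dmap_sum => //; apply: dmap_comp dbr dl.
  - exact: Dfn_not.
  - by apply: Dfn_subst dE; apply: dmap_sum => //; apply: dmap_comp dbr dr.
move=> e [z [x|y]] [/= cz [tg cx]].
  rewrite -(DP (sum_env (envl e) (envl (envl (envr e)))) (z, x)); last by split.
  by split=> [[H _]|H]; [apply: H|split].
rewrite -(EP (sum_env (envl e) (envr (envl (envr e)))) (z, y)); last by split.
by split=> [[_ H]|H]; [apply: H|split].
Qed.

(** A code of an element of one summand also fills the coordinates of the other. Sorts may be empty,
    so each summand has to be inhabited as soon as the other is. *)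
Lemma imaginary_sum : imaginary_set c -> imaginary_set d ->
  (X -> exists y : Y, True) -> (Y -> exists x : X, True) ->
  imaginary_set (sum_coding c d).
Proof.
move=> ic id XY YX; have [cf cs _ _] := ic; have [df ds _ _] := id.
apply: imaginary_intro.
- move=> e [x|y] [x'|y'] [t1 c1] [t2 c2] //; first by rewrite (cf _ _ _ c1 c2).
  by rewrite (df _ _ _ c1 c2).
- move=> [x|y].
    have [y _] := XY x; have [e ce] := cs x; have [e' ce'] := ds y.
    by exists (sum_env (sum_env e e') (ty' := fun=> s) (fun=> b0)).
  have [x _] := YX y; have [e ce] := cs x; have [e' ce'] := ds y.
  exists (sum_env (sum_env e e') (ty' := fun=> s) (fun b : bool => if b then b1 else b0)).
  by split=> // /esym.
- have H := Dfn_or (Dfn_and dtag (Dfn_subst dl (imaginary_dom ic)))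
    (Dfn_and (Dfn_not dtag) (Dfn_subst dr (imaginary_dom id))).
  apply: (Dfn_ext H) => e; split.
    by move=> [[t [x cx]]|[t [y cy]]]; [exists (inl x)|exists (inr y)].
  by move=> [[x|y] [t ct]]; [left|right]; split=> //; [exists x|exists y].
apply: zd_case; apply: zd_swap; apply: zd_case; apply: zd_swap => /=.
- by apply: (zd_ext (zd_eq ic)) => -[x y] /=; split=> [->|[->]].
- by apply: (zd_ext (zd_False _)).
- by apply: (zd_ext (zd_False _)).
- by apply: (zd_ext (zd_eq id)) => -[x y] /=; split=> [->|[->]].
Qed.

Lemma zfun_inl : imaginary_set c -> zfun c (sum_coding c d) inl.
Proof.
move=> ic; apply: zd_case => /=.
  by apply: (zd_ext (zd_eq ic)) => -[x y] /=; split=> [->|[->]].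
by apply: (zd_ext (zd_False _)).
Qed.

Lemma zfun_inr : imaginary_set d -> zfun d (sum_coding c d) inr.
Proof.
move=> id; apply: zd_case => /=; first by apply: (zd_ext (zd_False _)).
by apply: (zd_ext (zd_eq id)) => -[x y] /=; split=> [->|[->]].
Qed.

End Sum.

(** * Quotients by a definable equivalence of representatives *)

Section Quotient.
Variables (Z X : Type) (c : coding N Z) (rep : Z -> X -> Prop).

Definition quot_coding : coding N X :=
  @Coding L N X (cvar c) (cty c) (fun e x => exists2 z, code c e z & rep z x).

(** [Q] is constrained only at those [z] that represent something, so any formula in the
    representatives that is correct there will do. *)
Lemma zd_quot (Y : Type) (b : coding N Y) (Q : Y * Z -> Prop) (P : Y * X -> Prop) :
  zd (prod_coding b c) Q ->
  (forall y z x, rep z x -> (Q (y, z) <-> P (y, x))) ->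
  zd (prod_coding b quot_coding) P.
Proof.
move=> [D dD DQ] QP; exists D => // e [y x] [/= cy [z cz zx]].
rewrite -(QP _ _ _ zx); exact: (DQ e (y, z)).
Qed.

Lemma imaginary_quot (K : Z * Z -> Prop) : imaginary_set c ->
  (forall z x y, rep z x -> rep z y -> x = y) ->
  (forall x, exists z, rep z x) ->
  zd c (fun z => exists x, rep z x) -> zd (prod_coding c c) K ->
  (forall z z' x x', rep z x -> rep z' x' -> (K (z, z') <-> x = x')) ->
  imaginary_set quot_coding.
Proof.
move=> ic rf rs rd [E dE EK] KP; have [cf cs _ _] := ic; apply: imaginary_intro.
- move=> e x y [z cz zx] [z' cz' zy].
  by move: zy; rewrite (cf _ _ _ cz' cz); apply: rf.
- by move=> x; have [z zx] := rs x; have [e ce] := cs z; exists e, z.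
- apply: (Dfn_ext (zdef_of_zd cf (imaginary_dom ic) rd)) => e; split.
    by move=> [z cz [x zx]]; exists x, z.
  by move=> [x [z cz zx]]; exists z => //; exists x.
exists E => // e [x y] [/= [z cz zx] [z' cz' zy]].
rewrite -(KP _ _ _ _ zx zy); exact: (EK e (z, z')).
Qed.

End Quotient.
End Codings.

(** * Definability passes from [U] to an expansion *)

Section Lifting.
Variables (L : language) (U : structure L) (X : new_symbols L) (C : expansion U X).

Lemma Dfn_lift (V : Type) (ty : V -> lsort L) (D : env U ty -> Prop) :
  Dfn D -> @Dfn _ (exp_str C) V (old_ty X ty) D.
Proof.
move=> [phi phiP]; suff H : @Dfn _ (exp_str C) V (old_ty X ty) (fun e => sat (N := U) e phi).
  by apply: (Dfn_ext H) => e; apply: phiP.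
have lift_term W (tw : W -> lsort L) s (t : term tw s) :
    exists u : @term (expand X) _ (old_ty X tw) (Some s),
    forall e, eval (N := exp_str C) e u = eval (N := U) e t.
  elim: t => [v|f args IH]; first by exists (Var (L := expand X) (old_ty X tw) v).
  exists (App (L := expand X) (f := inl f) (fun i => sval (cid (IH i)))) => e /=.
  congr fun_int; apply: functional_extensionality_dep => i.
  exact: svalP (cid (IH i)) e.
elim: phi {D phiP} => {V ty} [V ty|V ty s t u|V ty r args|V ty phi IH psi IH'|V ty s phi IH].
- exact: Dfn_False.
- have [t' tP] := lift_term _ _ _ t; have [u' uP] := lift_term _ _ _ u.
  by exists (Eq t' u') => e /=; rewrite tP uP.
- exists (Rel (L := expand X) (r := inl r)
    (fun i => sval (cid (lift_term _ _ _ (args i))))) => e /=.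
  set x := (fun i => _); set y := (fun i => _).
  have -> // : x = y; apply: functional_extensionality_dep => i.
  exact: svalP (cid (lift_term _ _ _ (args i))) e.
- exact: Dfn_imp.
- apply: (@Dfn_all1 (expand X) (exp_str C) V (old_ty X ty) (Some s)
    (fun e x => sat (N := U) (ext_env (N := U) e x) phi)).
  (* Extending the lifted context and lifting the extended context agree only after case analysis on
     the variable; the renaming [t] passes from one to the other. *)
  pose ty1 := @ext_ty (lsort (expand X)) V (old_ty X ty) (Some s).
  pose t (e : env (exp_str C) ty1) : env (exp_str C) (old_ty X (ext_ty ty s)) :=
    ext_env (N := U) (fun v => e (Some v)) (e None).
  apply: (Dfn_subst (t := t) _ IH).
  by move=> [v|]; [exists (Var ty1 (Some v))|exists (Var ty1 None)].
Qed.

Lemma zd_lift (Y : Type) (c : coding U Y) (P : Y -> Prop) :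
  zd c P -> zd (lift_coding C c) P.
Proof. by move=> [D dD DP]; exists D => //; apply: Dfn_lift. Qed.

Lemma tracked_lift_prod (Y Z : Type) (c : coding U Y) (d : coding U Z) :
  tracked (prod_coding (lift_coding C c) (lift_coding C d))
    (lift_coding C (prod_coding c d)) id.
Proof.
pose ty1 := cty (prod_coding (lift_coding C c) (lift_coding C d)).
exists (fun e : env (exp_str C) ty1 =>
  @sum_env _ U _ _ (cty c) (cty d) (fun v => e (inl v)) (fun w => e (inr w))); last by [].
by move=> [v|w]; [exists (Var ty1 (inl v))|exists (Var ty1 (inr w))].
Qed.

Lemma zd_lift_prod (Y Z : Type) (c : coding U Y) (d : coding U Z) (P : Y * Z -> Prop) :
  zd (prod_coding c d) P -> zd (prod_coding (lift_coding C c) (lift_coding C d)) P.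
Proof. by move=> /zd_lift dP; apply: (zd_pull dP); apply: tracked_lift_prod. Qed.

Lemma imaginary_lift (Y : Type) (c : coding U Y) :
  imaginary_set c -> imaginary_set (lift_coding C c).
Proof.
move=> ic; have [cf cs _ _] := ic; apply: imaginary_intro => //.
  exact: Dfn_lift (imaginary_dom ic).
exact: zd_lift_prod (zd_eq ic).
Qed.

End Lifting.

Lemma sval_inj (T : Type) (P : T -> Prop) : injective (fun x : {x | P x} => sval x).
Proof. by move=> [x p] [y r] /= e; subst y; congr exist. Qed.

Lemma bijective_of_inj_surj (X Y : Type) (f : X -> Y) :
  injective f -> (forall y, exists x, f x = y) -> bijective f.
Proof.
move=> fi /choice [g gP]; exists g => // x; apply: fi; exact: gP.
Qed.

Lemma existT_inj (T : Type) (P : T -> Type) (x : T) (a b : P x) :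
  existT P x a = existT P x b -> a = b.
Proof.
move=> e; have := projT2_eq e.
by rewrite (Prop_irrelevance (projT1_eq e) erefl).
Qed.

(** * Morphisms as bijections between objects *)

Section GroupoidFacts.
Variables (G : groupoid_data) (hg : groupoid G).

Lemma act_uniq (m : mor G) x y y' : act m x y -> act m x y' -> y = y'.
Proof.
move=> a a'; have [lx _] := act_dom hg a.
by have [z [_ zu]] := act_fun hg lx; rewrite -(zu _ a) -(zu _ a').
Qed.

Lemma act_uniql (m : mor G) x x' y : act m x y -> act m x' y -> x = x'.
Proof.
move=> a a'; have [_ ly] := act_dom hg a.
by have [z [_ zu]] := act_bij hg ly; rewrite -(zu _ a) -(zu _ a').
Qed.

Definition app (m : mor G) (x : pt G) : pt G :=
  match pselect (loc x = src m) with
  | left h => sval (cid (act_fun hg h))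
  | right _ => x
  end.

Lemma app_act (m : mor G) (x : pt G) : loc x = src m -> act m x (app m x).
Proof. by rewrite /app; case: pselect => // h _; case: cid => y [] /=. Qed.

Lemma app_loc (m : mor G) (x : pt G) : loc x = src m -> loc (app m x) = tgt m.
Proof. by move=> /app_act /(act_dom hg) []. Qed.

Lemma act_app (m : mor G) x y : act m x y -> app m x = y.
Proof. by move=> a; have [lx _] := act_dom hg a; apply: act_uniq (app_act lx) a. Qed.

Lemma ex_id (m : mor G) : exists m' : mor G,
  [/\ src m' = src m, tgt m' = src m & forall x y, act m' x y <-> loc x = src m /\ x = y].
Proof.
have [n [sn tn nP]] := act_inv hg m.
have [|k [sk tk kP]] := act_comp hg (m := m) (m' := n); first by rewrite sn.
exists k; split=> //; first by rewrite tk.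
move=> x y; rewrite kP; split=> [[z [a /nP b]]|[lx <-]].
  by split; [case: (act_dom hg a)|apply: act_uniql a b].
by have [z [a _]] := act_fun hg lx; exists z; split=> //; apply/nP.
Qed.

Lemma mor_ext (m m' : mor G) : src m = src m' ->
  (forall x y, act m x y -> act m' x y) -> m = m'.
Proof.
move=> s sub; apply: (act_inj hg) => x y; split=> [/sub //|a].
have [lx _] := act_dom hg a; rewrite -s in lx.
have [z [b _]] := act_fun hg lx.
by rewrite (act_uniq a (sub _ _ b)).
Qed.

End GroupoidFacts.

(** * Isomorphisms of structures preserve satisfaction *)

Section Isomorphism.
Variables (L : language) (M N : structure L) (h : forall s, M s -> N s).
Hypotheses (h_inj : forall s, injective (h (s := s)))
  (h_surj : forall s y, exists x, h (s := s) x = y)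
  (h_rel : forall r x, rel_int N r (fun i => h (x i)) <-> rel_int M r x)
  (h_fun : forall f x, fun_int N f (fun i => h (x i)) = h (fun_int M f x)).

Lemma eval_iso (V : Type) (ty : V -> lsort L) (e : env M ty) s (t : term ty s) :
  eval (N := N) (fun v => h (e v)) t = h (eval e t).
Proof.
elim: t => //= f args IH; rewrite -h_fun; congr fun_int.
by apply: functional_extensionality_dep.
Qed.

Lemma sat_iso (V : Type) (ty : V -> lsort L) (e : env M ty) (phi : formula ty) :
  sat (N := N) (fun v => h (e v)) phi <-> sat e phi.
Proof.
elim: phi e => {V ty} [V ty|V ty s t u|V ty r args|V ty phi IH psi IH'|V ty s phi IH] e //=.
- by rewrite !eval_iso; split=> [/h_inj|->].
- rewrite -h_rel; set x := (fun i => _); set y := (fun i => _).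
  by have -> : x = y by apply: functional_extensionality_dep => i; apply: eval_iso.
- by rewrite IH IH'.
- have E x : ext_env (N := N) (fun v => h (e v)) (h x) = fun v => h (ext_env e x v).
    by apply: functional_extensionality_dep => -[].
  split=> H x; first by apply/IH; rewrite -E.
  by have [y <-] := h_surj x; rewrite E; apply/IH.
Qed.

End Isomorphism.

(** * Families over a finite type and over its ordinal enumeration *)

Section Unrank.
Variable W : finType.

(** Arities are indexed by ordinals, while the new relation has arguments naturally indexed by a
    finite type; [unrank] recovers the latter family from the former. *)
Definition unrank (T : W -> Type) (x : forall k : 'I_#|W|, T (enum_val k)) (w : W) :
    T w :=
  eq_rect _ T (x (enum_rank w)) _ (enum_rankK w).

Lemma unrank_val (T : W -> Type) (e : forall w, T w) :
  unrank (fun k => e (enum_val k)) = e.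
Proof.
apply: functional_extensionality_dep => w; rewrite /unrank.
by move: (enum_rank w) (enum_rankK w) => k; case: _ /.
Qed.

Lemma unrank_nat (T T' : W -> Type) (h : forall w, T w -> T' w)
    (x : forall k : 'I_#|W|, T (enum_val k)) (w : W) :
  unrank (fun k => h _ (x k)) w = h _ (unrank x w).
Proof.
by rewrite /unrank; move: (enum_rank w) (enum_rankK w) => k; case: _ /.
Qed.

End Unrank.

Lemma In_pmap (T : Type) (l : seq (option T)) (x : T) :
  List.In x (pmap id l) <-> List.In (Some x) l.
Proof.
elim: l => //= -[y|] l IH /=; rewrite IH; last by split=> [|[]]; [right| |].
by split=> [[->|]|[[->]|]]; by [left|right].
Qed.

(** * The cover attached to a section *)

Section Cover.
Variables (L : language) (U : structure L) (A : Type) (G : groupoid_data).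
Variables (q : ob G -> A) (cA : coding U A) (cI : coding U (ob G)).
Variables (cM : coding U (mor G)) (cO : coding U (pt G)).
Hypotheses (iA : imaginary_set cA) (iI : imaginary_set cI) (iM : imaginary_set cM)
  (hO : real_set cO) (hG : connected_family q) (hGdef : zdef_family cA q cI cM cO).
Variables (J : finType) (j0 : J).

Let iO : imaginary_set cO := hO.1.
Let hg : groupoid G := fam_groupoid hG.

(** Arguments of the new relation: [(j, Some w)] is coordinate [w] of the code of the [j]-th point
    of [G], and [(j, None)] is the [j]-th element of the new sort. *)
Definition rel_ctx (v : J * option (cvar cO)) : option (lsort L) :=
  if v.2 is Some w then Some (cty cO w) else None.

Definition cover_syms : new_symbols L :=
  @NewSymbols L unit void
    (fun _ => @Arity _ #|{: J * option (cvar cO)}| (fun k => rel_ctx (enum_val k)))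
    (fun f => match f with end) (fun f => match f with end).

Definition points (i : A -> ob G) : Type := {x : pt G | loc x = i (q (loc x))}.

Definition rel_holds (i : A -> ob G)
    (e : forall v, ext_carrier U (points i) (rel_ctx v)) : Prop :=
  exists m : mor G, forall j, exists2 o : pt G,
    code cO (fun w => e (j, Some w)) o & act m o (sval (e (j, None) : points i)).

Definition groupoid_cover (i : A -> ob G) : expansion U cover_syms :=
  @Expansion L U cover_syms (points i)
    (fun _ x => rel_holds (unrank (T := fun v => ext_carrier U (points i) (rel_ctx v)) x))
    (fun f => match f with end).

Notation "'US' i" := (exp_str (groupoid_cover i)) (at level 10, i at level 9).
Notation L' := (expand cover_syms).

Definition is_section (i : A -> ob G) : Prop := forall a, q (i a) = a.

(** * Covers for different sections are isomorphic over [U] *)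

Section ChangeOfSection.
Variables (i i' : A -> ob G) (si : is_section i) (si' : is_section i').
Variables (m : A -> mor G) (ms : forall a, src (m a) = i a) (mt : forall a, tgt (m a) = i' a).

Lemma move_subproof (x : points i) : let y := app hg (m (q (loc (sval x)))) (sval x) in
  loc y = i' (q (loc y)).
Proof.
case: x => x lx /=; rewrite app_loc; last by rewrite ms.
by rewrite mt si'.
Qed.

Definition move_pt (x : points i) : points i' := exist _ _ (move_subproof x).

Definition move_elt (s : lsort L') : US i s -> US i' s :=
  match s return US i s -> US i' s with Some _ => id | None => move_pt end.

Lemma move_act (x : points i) : act (m (q (loc (sval x)))) (sval x) (sval (move_pt x)).
Proof. by apply: app_act; rewrite ms; apply: svalP x. Qed.

Lemma move_fam (x : points i) : q (loc (sval (move_pt x))) = q (loc (sval x)).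
Proof. by have [_ ->] := act_dom hg (move_act x); rewrite mt si'. Qed.

Lemma move_inj s : injective (@move_elt s).
Proof.
case: s => [s|] //= x y xy; apply: sval_inj.
have := move_act x; have := move_act y.
by rewrite -(move_fam x) -(move_fam y) xy => ay ax; apply: act_uniql ax ay.
Qed.

Lemma move_surj s (y : US i' s) : exists x, @move_elt s x = y.
Proof.
case: s y => [s|] /= y; first by exists y.
have ly : loc (sval y) = tgt (m (q (loc (sval y)))) by rewrite mt; apply: svalP y.
have [x [ax _]] := act_bij hg ly; have [lx _] := act_dom hg ax.
have lx' : loc x = i (q (loc x)) by rewrite lx ms si.
exists (exist _ x lx'); apply: sval_inj => /=.
by apply: act_app; rewrite lx ms si.
Qed.

(** The relation asserts that some morphism exists, so it survives composition with [m a] or with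
    its inverse. Only one [a] is involved: all the entries lie in the target of that morphism, and
    [a] is read off at [j0]. *)
Lemma move_rel r x : rel_int (US i') r (fun k => move_elt (x k)) <-> rel_int (US i) r x.
Proof.
case: r x => [r|[]] //= x.
pose x' := unrank (T := fun v => ext_carrier U (points i) (rel_ctx v)) x.
have -> : unrank (T := fun v => ext_carrier U (points i') (rel_ctx v))
    (fun k => move_elt (s := rel_ctx (enum_val k)) (x k)) = fun v => move_elt (x' v).
  apply: functional_extensionality_dep => v.
  exact: (@unrank_nat _ (fun v => ext_carrier U (points i) (rel_ctx v))
    (fun v => ext_carrier U (points i') (rel_ctx v)) (fun v => @move_elt (rel_ctx v))).
rewrite -/x' /rel_holds; pose y j : points i := x' (j, None).
pose a := q (loc (sval (y j0))).
split=> -[n nP].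
- have tn : tgt n = i' a.
    by have [o _ /(act_dom hg) [_ <-]] := nP j0; rewrite (svalP (move_pt (y j0))) move_fam.
  have ya j : q (loc (sval (y j))) = a.
    by have [o _ /(act_dom hg) [_]] := nP j; rewrite tn -(si' a) -move_fam => ->.
  have [k [sk tk kP]] := act_inv hg (m a).
  have [|l [_ _ lP]] := act_comp hg (m := n) (m' := k); first by rewrite tn sk mt.
  exists l => j; have [o co ao] := nP j; exists o => //; apply/lP.
  exists (sval (move_pt (y j))); split=> //; apply/kP.
  by rewrite -(ya j); apply: move_act.
- have tn : tgt n = i a by have [o _ /(act_dom hg) [_ <-]] := nP j0; apply: svalP (y j0).
  have [|l [_ _ lP]] := act_comp hg (m := n) (m' := m a); first by rewrite tn ms.
  exists l => j; have [o co ao] := nP j; exists o => //; apply/lP.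
  have <- : q (loc (sval (y j))) = a by have [_ ->] := act_dom hg ao; rewrite tn si.
  by exists (sval (y j)); split=> //; apply: move_act.
Qed.

Lemma move_fun f x : fun_int (US i') f (fun k => move_elt (x k)) =
  move_elt (fun_int (US i) f x).
Proof. by case: f x => [f|[]]. Qed.

Lemma sat_move (V : Type) (ty : V -> lsort L') (e : env (US i) ty) (phi : formula ty) :
  sat (N := US i') (fun v => move_elt (e v)) phi <-> sat e phi.
Proof. exact: (sat_iso move_inj move_surj move_rel move_fun). Qed.

End ChangeOfSection.

(** * Translation of formulas about the cover into formulas about [U] *)

(** The variables that replace a single variable of sort [s]: one for an old sort, and the
    coordinates of a code of a point for the new sort. *)
Definition starvar (s : lsort L') : finType :=
  if s is Some _ then (unit : finType) else cvar cO.

Definition starty (s : lsort L') : starvar s -> lsort L :=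
  match s return starvar s -> lsort L with
  | Some s' => fun _ => s'
  | None => cty cO
  end.

(** The coding of points is real, so this is the only code of [x], and equality in the new sort
    translates into equality of tuples. *)
Definition pcode (x : pt G) : env U (cty cO) := sval (cid (code_surj iO x)).

Lemma pcodeP x : code cO (pcode x) x.
Proof. exact: svalP (cid (code_surj iO x)). Qed.

Lemma pcode_eq x y : code cO (pcode x) y -> y = x.
Proof. by move=> c; apply: (code_fun iO c (pcodeP x)). Qed.

Lemma code_pcode e x : code cO e x -> e = pcode x.
Proof. by move=> c; apply: hO.2 c (pcodeP x). Qed.

Definition star_elt (i : A -> ob G) (s : lsort L') : US i s -> env U (@starty s) :=
  match s return US i s -> env U (@starty s) with
  | Some s' => fun x _ => x
  | None => fun x => pcode (sval x)
  end.

Lemma star_elt_inj i s : injective (@star_elt i s).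
Proof.
case: s => [s|] x y /= e; first by have := congr1 (fun f => f tt) e.
by apply: sval_inj; apply: pcode_eq; rewrite -e; apply: pcodeP.
Qed.

Definition sty (V : Type) (ty : V -> lsort L') (v : {v : V & starvar (ty v)}) :
    lsort L := starty (projT2 v).

Definition star_env (i : A -> ob G) (V : Type) (ty : V -> lsort L')
    (e : env (US i) ty) : env U (@sty V ty) :=
  fun v => star_elt (e (projT1 v)) (projT2 v).

(** [l] lists finitely many variables that control a translation. Contexts may be infinite, while
    the clause for a quantifier over the new sort has to be a finite conjunction over the variables
    that matter. *)
Definition agree (V : Type) (ty : V -> lsort L') (l : seq V)
    (e1 e2 : env U (@sty V ty)) : Prop :=
  forall v w, List.In v l -> e1 (existT _ v w) = e2 (existT _ v w).

(* That [D] does not depend on the section is what makes the step for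
   quantifiers over the new sort work. *)
Definition translates (V : Type) (ty : V -> lsort L') (phi : formula ty)
    (l : seq V) (D : env U (@sty V ty) -> Prop) : Prop :=
  [/\ Dfn D, forall e1 e2, agree l e1 e2 -> D e1 -> D e2 &
      forall i (e : env (US i) ty), is_section i -> (sat e phi <-> D (star_env e))].

Lemma agree_sym V ty l (e1 e2 : env U (@sty V ty)) : agree l e1 e2 -> agree l e2 e1.
Proof. by move=> h v w /h ->. Qed.

Lemma agree_cat V ty l l' (e1 e2 : env U (@sty V ty)) :
  agree (l ++ l') e1 e2 -> agree l e1 e2 /\ agree l' e1 e2.
Proof. by move=> h; split=> v w vl; apply: h; apply/List.in_or_app; [left|right]. Qed.

Lemma agree_flatten (K : finType) V ty (l : K -> seq V) (e1 e2 : env U (@sty V ty)) :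
  agree (flatten [seq l k | k <- enum K]) e1 e2 -> forall k, agree (l k) e1 e2.
Proof.
move=> h k; have: k \in enum K by rewrite mem_enum.
elim: (enum K) h => //= k' ks IH /agree_cat [h1 h2].
by rewrite inE => /orP[/eqP->|/(IH h2)].
Qed.

(** The expansion adds no function symbols, so a term of the new sort is a variable and all other
    terms are built from old symbols. *)
Lemma translate_term (V : Type) (ty : V -> lsort L') (s : lsort L') (t : term ty s) :
  exists (l : seq V) (u : forall w : starvar s, term (@sty V ty) (starty w)),
  (forall e1 e2 : env U (@sty V ty), agree l e1 e2 ->
     forall w, eval e1 (u w) = eval e2 (u w)) /\
  forall i (e : env (US i) ty) w, eval (star_env e) (u w) = star_elt (eval e t) w.
Proof.
elim: t => [v|f args IH].
  exists [:: v], (fun w => Var (@sty V ty) (existT _ v w)); split=> // e1 e2 h w /=.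
  by apply: h; left.
case: f args IH => [f|[]] args IH.
have /choice [l lP] k := IH k.
pose u k := sval (cid (lP k)).
have uP k : (forall e1 e2 : env U (@sty V ty), agree (l k) e1 e2 ->
     forall w, eval e1 (u k w) = eval e2 (u k w)) /\
  forall i (e : env (US i) ty) w, eval (star_env e) (u k w) = star_elt (eval e (args k)) w.
  exact: svalP (cid (lP k)).
exists (flatten [seq l k | k <- enum 'I_(len (fun_ar f))]),
  (fun _ => App (f := f) (fun k => u k tt)); split=> [e1 e2 h w|i e w] /=.
  congr fun_int; apply: functional_extensionality_dep => k.
  by apply: (uP k).1; apply: agree_flatten h k.
congr fun_int; apply: functional_extensionality_dep => k.
by rewrite (uP k).2.
Qed.

Lemma zd_same_map : zd (prod_coding (pow_coding J cO) (pow_coding J cO))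
  (fun t => exists m, forall j, act m (t.1 j) (t.2 j)).
Proof.
set c := prod_coding _ _.
apply: (zd_ex (P := fun t m => forall j, act m (t.1 j) (t.2 j)) iM).
apply: zd_all_fin => j.
have z : zd (prod_coding (prod_coding cM cO) cO) (fun t => act t.1.1 t.1.2 t.2).
  by apply: zd_of_zdef (zdef_act hGdef); do !apply: imaginary_prod.
have t0 := tracked_id (prod_coding c cM).
apply: (zd_pull (f := fun t => ((t.2, t.1.1 j), t.1.2 j)) z).
apply: tracked_pair; last exact: (tracked_proj j (tracked_snd (tracked_fst t0))).
apply: tracked_pair; first exact: (tracked_snd t0).
exact: (tracked_proj j (tracked_fst (tracked_fst t0))).
Qed.

Let ctr (e : env U (@sty _ rel_ctx)) :
    env U (cty (prod_coding (pow_coding J cO) (pow_coding J cO))) :=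
  @sum_env _ U _ _ (cty (pow_coding J cO)) (cty (pow_coding J cO))
    (fun jw => e (existT (fun v => starvar (rel_ctx v)) (jw.1, Some jw.2) tt))
    (fun jw => e (existT (fun v => starvar (rel_ctx v)) (jw.1, None) jw.2)).

Let star_rel (e : env U (@sty _ rel_ctx)) : Prop :=
  exists2 t, code (prod_coding (pow_coding J cO) (pow_coding J cO)) (ctr e) t &
    exists m, forall j, act m (t.1 j) (t.2 j).

Let Dfn_star_rel : Dfn star_rel.
Proof.
apply: (Dfn_subst (t := ctr)
  (X := fun e => exists2 t, code (prod_coding (pow_coding J cO) (pow_coding J cO)) e t &
    exists m, forall j, act m (t.1 j) (t.2 j))).
  by move=> [[j w]|[j w]];
    [exists (Var (@sty _ rel_ctx) (existT (fun v => starvar (rel_ctx v)) (j, Some w) tt))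
    |exists (Var (@sty _ rel_ctx) (existT (fun v => starvar (rel_ctx v)) (j, None) w))].
have iP := imaginary_pow J iO.
apply: zdef_of_zd zd_same_map; first exact: prod_code_fun.
by apply: prod_code_dom; apply: imaginary_dom.
Qed.

Let rel_holds_star i (x : forall v, ext_carrier U (points i) (rel_ctx v)) :
  rel_holds x <-> star_rel (fun v => star_elt (i := i) (x (projT1 v)) (projT2 v)).
Proof.
split=> [[m mP]|[[o y] [co cy] [m mP]]].
  have /choice [o oP] j : exists o : pt G, code cO (fun w => x (j, Some w)) o /\
      act m o (sval (x (j, None) : points i)) by have [o] := mP j; exists o.
  exists (o, fun j => sval (x (j, None) : points i)); last by exists m => j; case: (oP j).
  by split=> j; [case: (oP j)|exact: (pcodeP (sval (x (j, None) : points i)))].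
exists m => j; exists (o j); first exact: co.
by rewrite -(pcode_eq (x := sval (x (j, None) : points i)) (cy j)); apply: mP.
Qed.

Definition sext (V : Type) (ty : V -> lsort L') (s : lsort L')
    (e : env U (@sty V ty)) (y : env U (@starty s)) :
    env U (@sty _ (ext_ty ty s)) :=
  fun vw => match vw return U (sty vw) with existT v w =>
    match v return forall w : starvar (ext_ty ty s v),
        U (@sty _ (ext_ty ty s) (existT (fun v => starvar (ext_ty ty s v)) v w)) with
    | Some v' => fun w => e (existT _ v' w)
    | None => fun w => y w
    end w end.

Lemma star_ext_env i (V : Type) (ty : V -> lsort L') (s : lsort L')
    (e : env (US i) ty) (x : US i s) :
  star_env (ext_env e x) = sext (star_env e) (star_elt x).
Proof. by apply: functional_extensionality_dep => -[[v|] w]. Qed.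

Definition is_pt (s : lsort L') : env U (@starty s) -> Prop :=
  match s return env U (@starty s) -> Prop with
  | Some _ => fun _ => True
  | None => fun y => exists x, code cO y x
  end.

(* Two points over the same [a] can both lie in the new sort of some section
   only if they lie in the same object. *)
Definition compat (s t : lsort L') :
    env U (@starty s) -> env U (@starty t) -> Prop :=
  match s, t return env U (@starty s) -> env U (@starty t) -> Prop with
  | None, None => fun y z => forall x x', code cO y x -> code cO z x' ->
      q (loc x) = q (loc x') -> loc x = loc x'
  | _, _ => fun _ _ => True
  end.

Lemma Dfn_is_pt s : Dfn (@is_pt s).
Proof. by case: s => [s|]; [apply: Dfn_True|apply: imaginary_dom]. Qed.

Lemma zd_loc_graph : zfun cO cI loc.
Proof. by apply: zd_of_zdef (zdef_loc hGdef); apply: imaginary_prod. Qed.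

Lemma zd_fam_graph : zfun cI cA q.
Proof. by apply: zd_of_zdef (zdef_fam hGdef); apply: imaginary_prod. Qed.

Lemma Dfn_compat s t :
  Dfn (fun e : env U (sum_ty (@starty s) (@starty t)) => compat (envl e) (envr e)).
Proof.
case: s t => [s|] [t|] /=; try exact: Dfn_True.
set c := prod_coding cO cO.
have z1 : zfun c cI (fun t => loc t.1).
  apply: (zfun_comp iO zd_loc_graph); apply: zfun_tracked => //.
  exact: tracked_fst (tracked_id _).
have z2 : zfun c cI (fun t => loc t.2).
  apply: (zfun_comp iO zd_loc_graph); apply: zfun_tracked => //.
  exact: tracked_snd (tracked_id _).
have [D dD DP] : zd c (fun t => q (loc t.1) = q (loc t.2) -> loc t.1 = loc t.2).
  apply: zd_imp; first apply: (zfun_eq iA); last exact: zfun_eq z1 z2.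
    exact: zfun_comp zd_fam_graph z1.
  exact: zfun_comp zd_fam_graph z2.
have dc : Dfn (fun e : env U (cty c) => exists t, code c e t).
  by apply: prod_code_dom; apply: imaginary_dom.
apply: (Dfn_ext (Dfn_imp dc dD)) => e; split=> [h x x' cx cx'|h [[x x'] [cx cx']]].
  by apply/(DP e (x, x')) => //; apply: h; exists (x, x').
by apply/(DP e (x, x')) => //=; apply: h.
Qed.

Lemma Dfn_compat_at (V : Type) (ty : V -> lsort L') (s : lsort L') (v : V) :
  Dfn (fun e : env U (sum_ty (@sty V ty) (@starty s)) =>
    compat (fun w => envl e (existT _ v w)) (envr e)).
Proof.
pose t (e : env U (sum_ty (@sty V ty) (@starty s))) :
    env U (sum_ty (@starty (ty v)) (@starty s)) :=
  sum_env (fun w => e (inl (existT _ v w))) (envr e).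
apply: (Dfn_subst (t := t) _ (@Dfn_compat (ty v) s)) => -[w|w].
  by exists (Var (sum_ty (@sty V ty) (@starty s)) (inl (existT _ v w))).
by exists (Var (sum_ty (@sty V ty) (@starty s)) (inr w)).
Qed.

Lemma Dfn_sext (V : Type) (ty : V -> lsort L') (s : lsort L')
    (D : env U (@sty _ (ext_ty ty s)) -> Prop) : Dfn D ->
  Dfn (fun e : env U (sum_ty (@sty V ty) (@starty s)) => D (sext (envl e) (envr e))).
Proof.
move=> dD; apply: Dfn_subst dD => -[[v|] w].
  by exists (Var (sum_ty (@sty V ty) (@starty s)) (inl (existT _ v w))).
by exists (Var (sum_ty (@sty V ty) (@starty s)) (inr w)).
Qed.

Lemma compat_points i s t (x : US i s) (y : US i t) :
  compat (star_elt x) (star_elt y).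
Proof.
case: s t x y => [s|] [t|] //= x y _ _ /pcode_eq -> /pcode_eq -> e.
by rewrite (svalP x) (svalP y) e.
Qed.

Lemma is_pt_star i s (x : US i s) : is_pt (star_elt x).
Proof. by case: s x => [s|] //= x; exists (sval x); apply: pcodeP. Qed.

(* If the object of [y] is not the one chosen by [i], change [i] at that single
   place: no variable in [P] notices. *)
Lemma realize_point i (si : is_section i) (V : Type) (ty : V -> lsort L')
    (e : env (US i) ty) (P : V -> Prop) s (y : env U (@starty s)) :
  is_pt y -> (forall v, P v -> compat (star_elt (e v)) y) ->
  exists x : US i s, forall phi l D, translates phi l D ->
    (forall v, List.In (Some v) l -> P v) ->
    (sat (ext_env e x) phi <-> D (sext (star_env e) y)).
Proof.
case: s y => [s|] y.
  move=> _ _; exists (y tt) => phi l D [_ _ phiD] _; rewrite (phiD i) // star_ext_env.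
  by have -> // : y = star_elt (i := i) (s := Some s) (y tt);
    apply: functional_extensionality_dep => -[].
move=> [y0 cy]; rewrite {y cy}(code_pcode cy) => ec; set a0 := q (loc y0).
have [ly|ly] := EM (loc y0 = i a0).
  by exists (exist _ y0 ly) => phi l D [_ _ phiD] _; rewrite (phiD i) // star_ext_env.
pose i' a := if pselect (a = a0) then loc y0 else i a.
have i'0 : i' a0 = loc y0 by rewrite /i'; case: pselect.
have i'N a : a <> a0 -> i' a = i a by rewrite /i'; case: pselect.
have si' : is_section i'.
  by move=> a; have [->|/i'N ->] := EM (a = a0); [rewrite i'0|apply: si].
(* The passage from [i] to [i'] uses identities over every [a] other than [a0], so that only points
   over [a0] move. *)
have /choice [m mP] a : exists m : mor G, [/\ src m = i a, tgt m = i' a &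
    a <> a0 -> forall x, loc x = i a -> act m x x].
  have [|m [sm tm]] := fam_conn hG (i := i a) (j := i' a); first by rewrite si si'.
  have [->|an] := EM (a = a0).
    have [|n [sn tn]] := fam_conn hG (i := i a0) (j := i' a0); first by rewrite si si'.
    by exists n.
  have [n [sn tn nP]] := ex_id hg m; exists n; rewrite sn tn sm i'N //; split=> //.
  by move=> _ x lx; apply/nP; rewrite sm.
have ms a : src (m a) = i a by case: (mP a).
have mt a : tgt (m a) = i' a by case: (mP a).
have ly' : loc y0 = i' (q (loc y0)) by rewrite i'0.
have [x xE] := move_surj si si' ms mt (s := None) (exist _ y0 ly' : US i' None).
(* A point of the new sort compatible with [y0] cannot lie over [a0]: it would lie in [i a0], and
   then so would [y0]. *)
have fixed s (z : US i s) : compat (star_elt z) (pcode y0 : env U (@starty None)) ->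
    forall w, star_elt (move_elt si' ms mt z) w = star_elt z w.
  case: s z => [s|] //= z cz w.
  have za : q (loc (sval z)) <> a0.
    move=> E; apply: ly; rewrite -(cz _ _ (pcodeP _) (pcodeP _) E).
    by rewrite (svalP z) E.
  congr (pcode _ w); apply: act_app; have [_ _ h] := mP (q (loc (sval z))).
  by apply: h => //; apply: svalP z.
exists x => phi l D [_ Dl phiD] lP.
rewrite -(sat_move si si' ms mt) (phiD i') //.
have ag : agree l (star_env (fun v => move_elt si' ms mt (ext_env e x v)))
    (sext (star_env e) (pcode y0 : env U (@starty None))).
  move=> [v|] w vl; last first.
    exact: (congr1 (fun z : US i' None => star_elt z w) xE).
  exact: fixed (ec _ (lP _ vl)) w.
by split; apply: Dl => //; apply: agree_sym.
Qed.

(** In the quantifier case, [realize_point] turns each admissible tuple into an element of the cover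
    with the same behaviour, and [compat_points] with [is_pt_star] shows that every element of the
    cover gives an admissible tuple. *)
Lemma translate (V : Type) (ty : V -> lsort L') (phi : formula ty) :
  exists l D, translates phi l D.
Proof.
elim: phi => {V ty} [V ty|V ty s t u|V ty r args|V ty phi [l [D [dD Dl DP]]]
  psi [l' [D' [dD' Dl' DP']]]|V ty s phi [l [D lD]]].
- by exists [::], (fun _ => False); split=> //; apply: Dfn_False.
- have [l [t' [tl tP]]] := translate_term t; have [l' [u' [ul uP]]] := translate_term u.
  exists (l ++ l'), (fun e => forall w, eval e (t' w) = eval e (u' w)); split.
  + apply: Dfn_all_fin => w; apply: Dfn_eq; [by exists (t' w)|by exists (u' w)].
  + by move=> e1 e2 /agree_cat [h1 h2] H w; rewrite -(tl _ _ h1) -(ul _ _ h2).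
  + move=> i e si /=; split=> [E w|E]; first by rewrite tP uP E.
    apply: star_elt_inj; apply: functional_extensionality_dep => w.
    by rewrite -tP -uP.
- have /choice [l lP] k := translate_term (args k).
  pose u k := sval (cid (lP k)).
  have uP k : (forall e1 e2 : env U (@sty V ty), agree (l k) e1 e2 ->
       forall w, eval e1 (u k w) = eval e2 (u k w)) /\
    forall i (e : env (US i) ty) w,
      eval (star_env e) (u k w) = star_elt (eval e (args k)) w.
    exact: svalP (cid (lP k)).
  case: r args l lP u uP => [r|[]] /= args l lP u uP.
    exists (flatten [seq l k | k <- enum 'I_(len (rel_ar r))]),
      (fun e => rel_int U r (fun k => eval e (u k tt))); split.
    + by exists (Rel (r := r) (fun k => u k tt)).
    + move=> e1 e2 h; set x := (fun k => _); set y := (fun k => _).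
      have -> // : x = y; apply: functional_extensionality_dep => k.
      by apply: (uP k).1; apply: agree_flatten h k.
    + move=> i e si /=; set x := (fun k => _); set y := (fun k => _).
      have -> // : x = y; apply: functional_extensionality_dep => k.
      by rewrite /y (uP k).2.
  pose T v := forall w : starvar (rel_ctx v), term (@sty V ty) (starty w).
  pose t (e : env U (@sty V ty)) : env U (@sty _ rel_ctx) :=
    fun vw => eval e (unrank (T := T) u (projT1 vw) (projT2 vw)).
  exists (flatten [seq l k | k <- enum 'I_#|{: J * option (cvar cO)}|]),
    (fun e => star_rel (t e)); split.
  + apply: Dfn_subst Dfn_star_rel => vw.
    by exists (unrank (T := T) u (projT1 vw) (projT2 vw)).
  + move=> e1 e2 h; have -> // : t e1 = t e2.
    apply: functional_extensionality_dep => -[v w]; rewrite /t /unrank /=.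
    move: (enum_rank v) (enum_rankK v) => k kv; case: _ / kv w => w /=.
    by apply: (uP k).1; apply: agree_flatten h k.
  + move=> i e si; rewrite /= rel_holds_star.
    set x := (fun vw => _); have -> // : x = t (star_env e).
    apply: functional_extensionality_dep => -[v w]; rewrite /x /t /unrank /=.
    move: (enum_rank v) (enum_rankK v) => k kv; case: _ / kv w => w /=.
    by rewrite (uP k).2.
- exists (l ++ l'), (fun e => D e -> D' e); split; first exact: Dfn_imp.
  + move=> e1 e2 /agree_cat [h1 h2] H D2; apply: (Dl' _ _ h2); apply: H.
    by apply: Dl D2; apply: agree_sym.
  + by move=> i e si /=; rewrite DP // DP'.
- have [dD Dl DP] := lD.
  (* [pmap id l] removes the bound variable from [l]. Compatibility is imposed only with the
     remaining variables, which keeps the condition first-order. *)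
  exists (pmap id l), (fun e => forall y : env U (@starty s), is_pt y ->
    (forall v, List.In v (pmap id l) -> compat (fun w => e (existT _ v w)) y) ->
    D (sext e y)); split.
  + apply: Dfn_all; apply: Dfn_imp.
      exact: Dfn_subst (@dmap_envr _ _ _ _ _ _) (@Dfn_is_pt s).
    apply: Dfn_imp.
      by apply: Dfn_all_list => v; apply: Dfn_compat_at.
    exact: Dfn_sext.
  + move=> e1 e2 h H y py cy; apply: (Dl (sext e1 y)).
      by move=> [v|] w vl //=; apply: h; apply/In_pmap.
    apply: H => // v vl; have := cy v vl; set f := (fun w => _); set g := (fun w => _).
    have -> // : f = g; apply: functional_extensionality_dep => w.
    by rewrite /f /g h.
  + move=> i e si; split=> /= H.
      move=> y py cy.
      have [x xP] := realize_point si (e := e) (P := fun v => List.In v (pmap id l)) py cy.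
      apply/(xP phi l D lD); last exact: H.
      by move=> v; rewrite In_pmap.
    move=> x; rewrite (DP i) // star_ext_env; apply: H; first exact: is_pt_star.
    by move=> v _; exact: (compat_points (e v) x).
Qed.

(** * Stable embeddedness and finite generation *)

(** In the translation of a formula defining [D], each parameter of the cover is replaced by a
    finite tuple of elements of [U], so the translation defines [D] in [U] with parameters. *)
Lemma cover_stably_embedded i : is_section i -> stably_embedded (groupoid_cover i).
Proof.
move=> si V ty D [phi phiP]; have [l [E [dE _ EP]]] := translate phi.
pose tB := @elt_ty _ (US i) (fun _ => True).
pose t (e : env U (sum_ty ty (@sty _ tB))) :
    env U (@sty _ (sum_ty (old_ty cover_syms ty) tB)) :=
  fun vw => match vw return U (sty vw) with existT v w =>
    match v return forall w : starvar (sum_ty (old_ty cover_syms ty) tB v),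
      U (@sty _ (sum_ty (old_ty cover_syms ty) tB) (existT _ v w)) with
    | inl v' => fun w => e (inl v')
    | inr b => fun w => e (inr (existT _ b w))
    end w end.
have dt : dmap t.
  move=> [[v|b] w]; first by exists (Var (sum_ty ty (@sty _ tB)) (inl v)).
  by exists (Var (sum_ty ty (@sty _ tB)) (inr (existT _ b w))).
have [psi psiP] := definable_of_Dfn (star_env (@elt_env _ (US i) (fun _ => True)))
  (Dfn_subst dt dE).
exists psi => e; rewrite psiP -phiP (EP i) //.
set x := t _; set y := star_env _; have -> // : x = y.
by apply: functional_extensionality_dep => -[[v|b] w].
Qed.

Lemma formula_in_all (V : Type) (ty : V -> lsort L') (phi : formula ty) :
  formula_in (fun _ => True) (fun _ => True) phi.
Proof.
have tin W (tw : W -> lsort L') s (t : term tw s) : term_in (fun _ => True) t.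
  by elim: t.
by elim: phi => //= *; split=> //; apply: tin.
Qed.

Lemma cover_finitely_generated i : finitely_generated (groupoid_cover i).
Proof.
exists (fun _ => True), (fun _ => True); split.
- by exists [:: tt] => -[]; left.
- by exists [::] => -[].
by move=> V ty phi; exists phi => //; apply: formula_in_all.
Qed.

(** * Saturation of the cover *)

Section CoverSaturation.
Hypotheses (satU : saturated U) (nU : card_lt nat (elt U)).

Lemma embeds_elt_cover i : embeds (elt (US i)) (elt U).
Proof.
have nat_U := embeds_nat_of_card_lt nU.
have [f fi] := embeds_sum nat_U (ex_intro _ id (fun _ _ => id))
  (embeds_fun (cvar cO) nat_U).
pose g (s : lsort L') : US i s -> elt U + (cvar cO -> elt U) :=
  match s return US i s -> _ with
  | Some s => fun x => inl (existT U s x)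
  | None => fun x => inr (fun w => existT U (cty cO w) (pcode (sval x) w))
  end.
exists (fun b => f (g (projT1 b) (projT2 b))) => -[[s|] x] [[t|] y] /= /fi //.
  move=> E; have E' : existT U s x = existT U t y.
    exact: (congr1 (fun z => if z is inl b then b else existT U s x) E).
  exact: (congr1 (fun b : elt U => existT (US i) (Some (projT1 b)) (projT2 b)) E').
move=> [E]; congr existT; apply: (@star_elt_inj i None).
apply: functional_extensionality_dep => w.
by apply: existT_inj (congr1 (fun h => h w) E).
Qed.

(** The type is translated and realized in [U] by a tuple, and [realize_point] converts that tuple
    into an element of the cover, possibly after a change of section at one place. *)
Lemma cover_saturated i : is_section i -> saturated (US i).
Proof.
move=> si B Blt s p fin.
pose V := {b : elt (US i) | B b}; pose ty := @elt_ty _ (US i) B.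
pose e : env (US i) ty := @elt_env _ (US i) B.
have /choice [l /choice [D lD]] := fun phi => @translate _ (ext_ty ty s) phi.
(* Besides satisfying the translated formulas, the tuple must code a point compatible with every
   parameter: the translation of a single formula involves only finitely many of them, yet one
   element has to serve for all. *)
pose X (j : {phi | p phi} + V + unit) (e : env U (@sty V ty))
    (y : env U (@starty s)) : Prop :=
  match j with
  | inl (inl phi) => D (sval phi) (sext e y)
  | inl (inr v) => compat (fun w => e (existT _ v w)) y
  | inr _ => is_pt y
  end.
have sp phi : translates phi (l phi) (D phi) by apply: lD.
have [||k|y yP] := realize satU nU (X := X) (e := star_env e).
- pose code_w (t : lsort L') : starvar t -> option (cvar cO) :=
    match t return starvar t -> option (cvar cO) with
    | Some _ => fun _ => None | None => fun w => Some w end.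
  have ci t : injective (@code_w t) by case: t => [t [] []|w w' []].
  apply: card_lt_mul_fin nU _ (embeds_elt_cover i) Blt.
  exists (fun vw => (projT1 vw, code_w _ (projT2 vw))) => -[v w] [v' w'] /= [] E.
  by subst v' => /ci ->.
- move=> [[phi|v]|[]] /=.
  + by have [dD _ _] := sp (sval phi); apply: Dfn_sext.
  + exact: Dfn_compat_at.
  + exact: Dfn_subst (@dmap_envr _ _ _ _ _ _) (@Dfn_is_pt s).
(* In a finite list of conditions only those from formulas of [p] have to be realized; the other two
   kinds hold for every element of the cover. *)
- have [|x xP] := fin (pmap (fun j => if j is inl (inl phi) then Some (sval phi) else None) k).
    elim: k => //= -[[phi|v]|u] k IH //= psi [<-|/IH //]; exact: svalP phi.
  exists (star_elt x) => -[[phi|v]|[]] jk /=.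
  + rewrite -star_ext_env; have [_ _ DP] := sp (sval phi); apply/(DP i) => //.
    apply: xP; elim: k jk => //= j k IH [->|/IH h]; first by left.
    by case: j => [[psi|v]|u] //; right.
  + exact: (compat_points (e v) x).
  + exact: is_pt_star.
have [||x xP] := realize_point si (e := e) (P := fun _ => True) (y := y).
- exact: (yP (inr tt)).
- by move=> v _; apply: (yP (inl (inr v))).
exists x => phi pphi; apply/(xP _ _ _ (sp phi)) => //.
exact: (yP (inl (inl (exist _ phi pphi)))).
Qed.

End CoverSaturation.
End Cover.

(** * The groupoid with one new object over each [a] *)

Section ExtendedGroupoid.
Variables (A : Type) (G : groupoid_data) (q : ob G -> A) (hG : connected_family q).
Variables (i : A -> ob G) (si : is_section q i).

Let hg : groupoid G := fam_groupoid hG.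

Definition real_ob (u : ob G + A) : ob G := match u with inl o => o | inr a => i a end.

Definition real_pt (x : pt G + points q i) : pt G :=
  match x with inl y => y | inr s => sval s end.

Definition ext_loc (x : pt G + points q i) : ob G + A :=
  match x with inl y => inl (loc y) | inr s => inr (q (loc (sval s))) end.

(** A morphism of [G] between underlying objects. Source and target are recorded separately because
    the new object over [a] and [i a] have the same underlying object. *)
Record ext_morphism := ExtMorphism {
  ext_src : ob G + A;
  ext_tgt : ob G + A;
  real_mor : mor G;
  real_src : src real_mor = real_ob ext_src;
  real_tgt : tgt real_mor = real_ob ext_tgt
}.

Definition ext_groupoid : groupoid_data :=
  @GroupoidData (ob G + A) ext_morphism (pt G + points q i) ext_src ext_tgt ext_loc
    (fun m x y => [/\ ext_loc x = ext_src m, ext_loc y = ext_tgt m &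
                      act (real_mor m) (real_pt x) (real_pt y)]).

Notation G' := ext_groupoid.

Definition ext_fam (u : ob G') : A := match u with inl o => q o | inr a => a end.

Lemma real_loc (x : pt G') : loc (real_pt x) = real_ob (loc x).
Proof. by case: x => [x|[s ls]] //=. Qed.

Lemma fam_real_ob (u : ob G') : q (real_ob u) = ext_fam u.
Proof. by case: u => //= a; apply: si. Qed.

Lemma real_pt_inj (x y : pt G') : loc x = loc y -> real_pt x = real_pt y -> x = y.
Proof.
case: x y => [x|x] [y|y] //= _; first by move=> ->.
by move=> /sval_inj ->.
Qed.

Lemma lift_pt (u : ob G') (z : pt G) : loc z = real_ob u ->
  exists2 x : pt G', loc x = u & real_pt x = z.
Proof.
case: u => [o|a] /= lz; first by exists (inl z) => //=; rewrite lz.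
have lz' : loc z = i (q (loc z)) by rewrite lz si.
by exists (inr (exist _ z lz')) => //=; rewrite lz si.
Qed.

Lemma ext_morphism_eq (m n : ext_morphism) : ext_src m = ext_src n ->
  ext_tgt m = ext_tgt n -> real_mor m = real_mor n -> m = n.
Proof.
case: m n => [u v m s t] [u' v' m' s' t'] /= eu ev em; subst u' v' m'.
by rewrite (Prop_irrelevance s s') (Prop_irrelevance t t').
Qed.

Lemma ext_groupoidP : groupoid G'.
Proof.
have afun (m : mor G') x : loc x = src m -> exists! y, act m x y.
  move=> lx; have [|z [az _]] := act_fun hg (m := real_mor m) (x := real_pt x).
    by rewrite real_loc lx real_src.
  have [|y ly yz] := lift_pt (u := tgt m) (z := z).
    by have [_ ->] := act_dom hg az; rewrite real_tgt.
  exists y; split=> [|y' [_ ly' ay']]; first by split=> //; rewrite yz.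
  apply: real_pt_inj; first exact: etrans ly (esym ly').
  by rewrite yz; apply: act_uniq az ay'.
split=> //.
- move=> u; have [z lz] := loc_surj hg (real_ob u).
  by have [x lx _] := lift_pt lz; exists x.
- by move=> m x y [].
- move=> m y ly; have [|z [az _]] := act_bij hg (m := real_mor m) (y := real_pt y).
    by rewrite real_loc ly real_tgt.
  have [|x lx xz] := lift_pt (u := src m) (z := z).
    by have [-> _] := act_dom hg az; rewrite real_src.
  exists x; split=> [|x' [lx' _ ax']]; first by split=> //; rewrite xz.
  apply: real_pt_inj; first exact: etrans lx (esym lx').
  by rewrite xz; apply: act_uniql az ax'.
- move=> m n mn.
  (* Objects have points, and a single point with its image already determines the source and target
     of a morphism. *)
  have [z lz] := loc_surj hg (real_ob (src m)); have [x lx _] := lift_pt lz.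
  have [y [axy _]] := afun m x lx; have /mn [/= lx' ly' _] := axy; case: axy => _ ly _.
  have es : ext_src m = ext_src n := etrans (esym lx) lx'.
  apply: ext_morphism_eq => //; first exact: etrans (esym ly) ly'.
  apply: (mor_ext hg); first by rewrite !real_src es.
  move=> x1 y1 a1; have [l1 l2] := act_dom hg a1.
  have [|x2 lx2 xE] := lift_pt (u := src m) (z := x1); first by rewrite l1 real_src.
  have [|y2 ly2 yE] := lift_pt (u := tgt m) (z := y1); first by rewrite l2 real_tgt.
  have /mn [_ _] : act m x2 y2 by split=> //; rewrite xE yE.
  by rewrite xE yE.
- move=> m n mn; have [|k [sk tk kP]] := act_comp hg (m := real_mor m) (m' := real_mor n).
    by rewrite real_tgt real_src; congr real_ob.
  have sk' : src k = real_ob (src m) by rewrite sk real_src.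
  have tk' : tgt k = real_ob (tgt n) by rewrite tk real_tgt.
  exists (ExtMorphism sk' tk'); split=> // x z; split=> /=.
    move=> [lx lz /kP [y [a1 a2]]].
    have [|y' ly' yE] := lift_pt (u := tgt m) (z := y).
      by have [_ ->] := act_dom hg a1; rewrite real_tgt.
    by exists y'; rewrite yE; split; split=> //; apply: etrans ly' mn.
  move=> [y [[lx ly a1] [ly' lz a2]]]; split=> //; apply/kP.
  by exists (real_pt y).
- move=> m; have [k [sk tk kP]] := act_inv hg (real_mor m).
  have sk' : src k = real_ob (tgt m) by rewrite sk real_tgt.
  have tk' : tgt k = real_ob (src m) by rewrite tk real_src.
  exists (ExtMorphism sk' tk'); split=> // x z.
  by split=> -[/= l1 l2 a]; split=> //; apply/kP.
Qed.

Lemma ext_connected : connected_family ext_fam.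
Proof.
split=> [|a|m|u v uv]; first exact: ext_groupoidP.
- by exists (inr a).
- by rewrite -!fam_real_ob -real_src -real_tgt; apply: (fam_mor hG).
- have [|m [sm tm]] := fam_conn hG (i := real_ob u) (j := real_ob v).
    by rewrite !fam_real_ob.
  by exists (ExtMorphism sm tm).
Qed.

(** * Morphisms coded by a faithful tuple and its image *)

Section Faithful.
Variables (K : finType) (k0 : K).

Definition faithful_tuple (u : ob G) (x : K -> pt G) : Prop :=
  (forall k, loc (x k) = u) /\
  forall m : mor G, src m = u -> tgt m = u -> (forall k, act m (x k) (x k)) ->
    forall y, loc y = u -> act m y y.

(** [m] followed by the inverse of [n] fixes the faithful tuple, hence every point of the object. *)
Lemma faithful_act u x (m n : mor G) (y z : pt G) (t : K -> pt G) :
  faithful_tuple u x -> (forall k, act m (x k) (t k)) ->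
  (forall k, act n (x k) (t k)) -> act m y z -> act n y z.
Proof.
move=> [xu xf] mx nx myz.
have su (k : mor G) : (forall j, act k (x j) (t j)) -> src k = u.
  by move=> /(_ k0) /(act_dom hg) [<- _]; apply: xu.
have tm : tgt m = tgt n.
  by have [_ <-] := act_dom hg (mx k0); have [_ <-] := act_dom hg (nx k0).
have [n' [sn' tn' n'P]] := act_inv hg n.
have [|l [sl tl lP]] := act_comp hg (m := m) (m' := n'); first by rewrite tm sn'.
have ly : loc y = u by have [-> _] := act_dom hg myz; apply: su.
have /lP [z' [a1 /n'P a2]] : act l y y.
  apply: xf => //; first by rewrite sl su.
    by rewrite tl tn' su.
  by move=> k; apply/lP; exists (t k); split=> //; apply/n'P.
by rewrite (act_uniq hg myz a1).
Qed.

Definition snoc (X : Type) (x : K -> X) (y : X) (o : option K) : X :=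
  if o is Some k then x k else y.

Definition related (x y : option K -> pt G') : Prop :=
  exists m : mor G', forall o, act m (x o) (y o).

(** Triviality of the pointwise stabiliser of [x], written with [related] alone; it thus becomes
    definable before the morphisms of the extension have a coding. *)
Definition base (x : K -> pt G') : Prop :=
  forall y z, related (snoc x y) (snoc x z) -> y = z.

Definition rep (t : (K -> pt G') * (K -> pt G')) (m : mor G') : Prop :=
  base t.1 /\ forall k, act m (t.1 k) (t.2 k).

(** A morphism [n] with the same values as [m] on a base, followed by the inverse of [m], fixes that
    base and therefore moves nothing. The graph of [m] is thus recovered from any pair that
    represents it. *)
Lemma rep_related t m x y : rep t m -> (related (snoc t.1 x) (snoc t.2 y) <-> act m x y).
Proof.
have hg' := ext_groupoidP; move=> [bx mt]; split=> [[n nP]|a]; last first.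
  by exists m => -[k|] //=; apply: mt.
have tmn : tgt n = tgt m.
  by have [_ <-] := act_dom hg' (nP (Some k0)); have [_ <-] := act_dom hg' (mt k0).
have [m' [sm' tm' m'P]] := act_inv hg' m.
have [|l [sl tl lP]] := act_comp hg' (m := n) (m' := m'); first by rewrite tmn sm'.
have ly : loc y = tgt m by rewrite -tmn; case: (act_dom hg' (nP None)).
have [x' [ax' _]] := act_bij hg' ly.
rewrite (bx x x') //; exists l => -[k|]; apply/lP.
  by exists (t.2 k); split; [apply: (nP (Some k))|apply/m'P; apply: mt].
by exists y; split; [apply: (nP None)|apply/m'P].
Qed.

Lemma rep_fun t m n : rep t m -> rep t n -> m = n.
Proof.
move=> rm rn; apply: (act_inj ext_groupoidP) => x y.
by rewrite -(rep_related _ _ rm) -(rep_related _ _ rn).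
Qed.

Lemma rep_eq t t' m n : rep t m -> rep t' n ->
  ((forall x y, related (snoc t.1 x) (snoc t.2 y) <-> related (snoc t'.1 x) (snoc t'.2 y))
   <-> m = n).
Proof.
move=> rm rn; split=> [H|mn x y]; last first.
  by rewrite (rep_related _ _ rm) (rep_related _ _ rn) mn.
apply: (act_inj ext_groupoidP) => x y.
by rewrite -(rep_related _ _ rm) -(rep_related _ _ rn).
Qed.

Lemma rep_dom t : (exists m, rep t m) <->
  base t.1 /\ exists x y, related (snoc t.1 x) (snoc t.2 y).
Proof.
split=> [[m rm]|[bt [x [y [m mP]]]]].
  split; first by case: rm.
  by exists (t.1 k0), (t.2 k0); apply/(rep_related _ _ rm); case: rm.
by exists m; split=> // k; apply: (mP (Some k)).
Qed.

Hypothesis faithful : forall u, exists x, faithful_tuple u x.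

(** A faithful tuple of the underlying source object, lifted to the source of [m], is a base; its
    image under [m] completes the pair. *)
Lemma rep_surj (m : mor G') : exists t, rep t m.
Proof.
have hg' := ext_groupoidP.
have [x [xu xf]] := faithful (real_ob (src m)).
have /choice [x' xP] k : exists x' : pt G', loc x' = src m /\ real_pt x' = x k.
  by have [x' lx' xE] := lift_pt (xu k); exists x'.
have /choice [y yP] k : exists y, act m (x' k) y.
  by have [y [ay _]] := act_fun hg' (proj1 (xP k)); exists y.
exists (x', y); split=> //= z z' [n nP].
have sn : src n = src m.
  by have [<- _] := act_dom hg' (nP (Some k0)); case: (xP k0).
have tn : tgt n = src m.
  by have [_ <-] := act_dom hg' (nP (Some k0)); case: (xP k0).
have [lz lz' az] := nP None; apply: real_pt_inj; 
  first exact: etrans lz (etrans sn (esym (etrans lz' tn))).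
have az' : act (real_mor n) (real_pt z) (real_pt z).
  apply: xf; first by rewrite real_src; congr real_ob.
  - by rewrite real_tgt; congr real_ob.
  - by move=> k; have [_ _] := nP (Some k); rewrite /= (proj2 (xP k)).
  - by rewrite real_loc; congr real_ob; apply: etrans lz sn.
exact: (act_uniq hg az' az).
Qed.

End Faithful.
End ExtendedGroupoid.

(** Builds the proof that a composite of projections, pairings and evaluations at an index is
    [tracked], by recursion on the syntax of the function. *)
Ltac track_term b f :=
  lazymatch f with
  | (fun z => z) => constr:(tracked_id b)
  | @fst _ _ => constr:(tracked_fst (tracked_id b))
  | @snd _ _ => constr:(tracked_snd (tracked_id b))
  | (fun z => (@?g z, @?h z)) =>
      let p := track_term b g in let r := track_term b h in
      constr:(tracked_pair p r)
  | (fun z => fst (@?g z)) => let p := track_term b g in constr:(tracked_fst p)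
  | (fun z => snd (@?g z)) => let p := track_term b g in constr:(tracked_snd p)
  | (fun z => fst (@?g z) ?j) =>
      let p := track_term b g in constr:(tracked_proj j (tracked_fst p))
  | (fun z => snd (@?g z) ?j) =>
      let p := track_term b g in constr:(tracked_proj j (tracked_snd p))
  end.

Ltac track := cbv beta; lazymatch goal with
  | |- tracked ?b _ ?f => let p := track_term b f in exact p
  end.

Lemma zfun_case (L : language) (N : structure L) (s : lsort L) (X Y Z : Type)
    (c : coding N X) (d : coding N Y) (b : coding N Z) (f : X + Y -> Z) :
  zfun c b (fun x => f (inl x)) -> zfun d b (fun y => f (inr y)) ->
  zfun (sum_coding s c d) b f.
Proof. by move=> zl zr; apply: zd_swap; apply: zd_case; apply: zd_swap. Qed.

Lemma tracked_snoc (L : language) (N : structure L) (K : finType) (X Z : Type)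
    (b : coding N Z) (c : coding N X) (f : Z -> K -> X) (g : Z -> X) :
  tracked b (pow_coding K c) f -> tracked b c g ->
  tracked b (pow_coding (option K) c) (fun z => snoc (f z) (g z)).
Proof.
move=> tf tg; apply: tracked_tuple => -[k|] //=.
exact: (tracked_proj k tf).
Qed.

(** * Definability of the extended groupoid in the cover *)

Section CoverGroupoid.
Variables (L : language) (U : structure L) (A : Type) (G : groupoid_data).
Variables (q : ob G -> A) (cA : coding U A) (cI : coding U (ob G)).
Variables (cM : coding U (mor G)) (cO : coding U (pt G)).
Hypotheses (iA : imaginary_set cA) (iI : imaginary_set cI) (iM : imaginary_set cM)
  (hO : real_set cO) (hG : connected_family q) (hGdef : zdef_family cA q cI cM cO).
Variables (K : finType) (k0 : K).
Hypothesis faithful : forall u : ob G, exists x : K -> pt G, faithful_tuple u x.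
Variables (i : A -> ob G) (si : is_section q i).
Variables (s2 : lsort L) (b0 b1 : U s2).
Hypothesis b01 : b0 <> b1.

Let iO : imaginary_set cO := hO.1.
Let hg : groupoid G := fam_groupoid hG.

Notation J := (option K : finType).
Notation C := (groupoid_cover q cO J i).
Notation N := (exp_str C).
Notation S := (points q i).
Notation L' := (expand (cover_syms cO J)).
Notation G' := (ext_groupoid q i).
Notation old c := (lift_coding C c).

Definition cover_map (s : new_sort C) : A := q (loc (sval (s : S))).
Notation p := cover_map.

Lemma id_at (u : ob G) : exists m : mor G,
  [/\ src m = u, tgt m = u & forall x, loc x = u -> act m x x].
Proof.
have [n [sn _]] := fam_conn hG (erefl (q u)).
have [m [sm tm mP]] := ex_id hg n; exists m; rewrite sm tm sn; split=> // x lx.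
by apply/mP; rewrite sn.
Qed.

Definition newS : coding N S := new_coding C.

Lemma imaginary_new : imaginary_set newS.
Proof.
apply: imaginary_intro; first by move=> e x y /= <- <-.
- by move=> x; exists (fun _ => x).
- by apply: (Dfn_ext (@Dfn_True _ _ _ _)) => e; split=> // _; exists (e tt).
pose ty := cty (prod_coding newS newS).
exists (fun e : env N ty => e (inl tt) = e (inr tt)).
  by apply: Dfn_eq; [exists (Var ty (inl tt))|exists (Var ty (inr tt))].
by move=> e [x y] [/= <- <-].
Qed.

Notation rctx := (@rel_ctx L U G cO J).

Lemma Dfn_rel_holds : @Dfn L' N _ rctx (fun e => rel_holds (i := i) (q := q) e).
Proof.
exists (@Rel L' _ rctx (inr tt) (fun k => Var (L := L') rctx (enum_val k))) => e /=.
by rewrite (unrank_val (T := fun v => ext_carrier U S (rel_ctx v)) e).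
Qed.

Lemma zd_rel : zd (prod_coding (pow_coding J (old cO)) (pow_coding J newS))
  (fun t => exists m, forall j, act m (t.1 j) (sval (t.2 j))).
Proof.
pose ty := cty (prod_coding (pow_coding J (old cO)) (pow_coding J newS)).
pose t (e : env N ty) : env N rctx := fun v =>
  match v return N (rel_ctx v) with
  | (j, Some w) => e (inl (j, w))
  | (j, None) => e (inr (j, tt))
  end.
exists (fun e => rel_holds (i := i) (q := q) (t e)).
  apply: Dfn_subst Dfn_rel_holds => -[j [w|]].
    by exists (Var ty (inl (j, w))).
  by exists (Var ty (inr (j, tt))).
move=> e [o x] [/= co cx]; split=> -[m mP]; exists m => j.
  have [o' co' a] := mP j; rewrite (code_fun iO (co j) co') -(cx j); exact: a.
exists (o j); first exact: co.
by have := mP j; rewrite -(cx j).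
Qed.

(** The new relation is the only link between the new sort and [U]: [s] lies over the same [a] as
    any point of [G] related to it, since morphisms stay inside fibres. The constant tuple at the
    point underlying [s] shows that one exists. *)
Lemma zfun_cover_map : zfun newS (old cA) p.
Proof.
have iS := imaginary_new; have iO' := imaginary_lift C iO.
have iA' := imaginary_lift C iA; have iI' := imaginary_lift C iI.
apply: (@zd_ext _ _ _ _ (fun t => exists z : J -> pt G,
  (exists m, forall j, act m (z j) (sval t.1)) /\ t.2 = q (loc (z None)))); last first.
  move=> [s a] /=; split=> [[z [[m mP] ->]]|->].
    have [l1 l2] := act_dom hg (mP None); rewrite /cover_map l1 l2.
    exact: fam_mor hG m.
  have [m [_ _ mP]] := id_at (loc (sval s)).
  by exists (fun _ => sval s); split=> //; exists m => _; apply: mP.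
set c := prod_coding newS (old cA).
apply: (zd_ex (P := fun t (z : J -> pt G) =>
  (exists m, forall j, act m (z j) (sval t.1)) /\ t.2 = q (loc (z None)))
  (imaginary_pow J iO')).
apply: zd_and.
  apply: (zd_pull (f := fun t => (t.2, fun _ : J => t.1.1)) zd_rel).
  by apply: tracked_pair; [track|apply: tracked_tuple => j; track].
apply: (zfun_eq iA'); first by apply: zfun_tracked => //; track.
apply: (zfun_comp iI' (zd_lift_prod C (zd_fam_graph iA iI hGdef))).
apply: (zfun_comp iO' (zd_lift_prod C (zd_loc_graph iI hO hGdef))).
by apply: zfun_tracked => //; track.
Qed.

Definition ext_ob_coding : coding N (ob G') :=
  sum_coding (Some s2 : lsort L') (old cI) (old cA).
Definition ext_pt_coding : coding N (pt G') := sum_coding (Some s2 : lsort L') (old cO) newS.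

Lemma imaginary_ext_ob : imaginary_set ext_ob_coding.
Proof.
apply: (@imaginary_sum _ _ _ (b0 : N (Some s2)) b1 b01).
- exact: imaginary_lift.
- exact: imaginary_lift.
- by move=> o; exists (q o).
- by move=> a; exists (i a).
Qed.

Lemma imaginary_ext_pt : imaginary_set ext_pt_coding.
Proof.
apply: (@imaginary_sum _ _ _ (b0 : N (Some s2)) b1 b01).
- exact: imaginary_lift.
- exact: imaginary_new.
- move=> x; have [y ly] := loc_surj hg (i (q (loc x))).
  have ly' : loc y = i (q (loc y)) by rewrite ly si.
  by exists (exist _ y ly').
- by move=> s; exists (sval s).
Qed.

Lemma zfun_ext_loc : zfun ext_pt_coding ext_ob_coding (@loc G').
Proof.
apply: zfun_case => /=.
  apply: (zfun_comp (imaginary_lift C iI) (zfun_inl _ _ (imaginary_lift C iI))).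
  exact: zd_lift_prod (zd_loc_graph iI hO hGdef).
apply: (zfun_comp (imaginary_lift C iA) (zfun_inr _ _ (imaginary_lift C iA))).
exact: zfun_cover_map.
Qed.

Lemma zfun_ext_fam : zfun ext_ob_coding (old cA) (@ext_fam A G q i).
Proof.
apply: zfun_case => /=; first exact: zd_lift_prod (zd_fam_graph iA iI hGdef).
by apply: (zfun_tracked (f := fun a => a) (imaginary_lift C iA)); track.
Qed.

(** The right-hand tuple lies in a single object, so its entries are all old or all new. The action
    of [G] handles the first case and the new relation the second. *)
Lemma zd_real_related : zd (prod_coding (pow_coding J (old cO)) (pow_coding J ext_pt_coding))
  (fun t => exists m u, forall j, act m (t.1 j) (real_pt (t.2 j)) /\ loc (t.2 j) = u).
Proof.
have iO' := imaginary_lift C iO; have iS := imaginary_new.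
apply: (@zd_ext _ _ _ _ (fun t =>
  (exists x : J -> pt G, (forall j, t.2 j = inl (x j)) /\
     exists m, forall j, act m (t.1 j) (x j)) \/
  (exists s : J -> S, (forall j, t.2 j = inr (s j)) /\
     exists m, forall j, act m (t.1 j) (sval (s j))))); last first.
  move=> [z x] /=; split.
    move=> [[y [xE [m mP]]]|[y [xE [m mP]]]].
      exists m, (inl (tgt m)) => j; rewrite xE /=; split=> //.
      by have [_ ->] := act_dom hg (mP j).
    exists m, (inr (q (tgt m))) => j; rewrite xE /=; split=> //.
    by have [_ ->] := act_dom hg (mP j).
  move=> [m [[o|a] mP]].
    left; have /choice [y yP] j : exists y, x j = inl y.
      by have [_] := mP j; case: (x j) => // y _; exists y.
    by exists y; split=> //; exists m => j; have [] := mP j; rewrite yP.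
  right; have /choice [y yP] j : exists y, x j = inr y.
    by have [_] := mP j; case: (x j) => // y _; exists y.
  by exists y; split=> //; exists m => j; have [] := mP j; rewrite yP.
set c := prod_coding _ _; apply: zd_or.
  apply: (zd_ex (P := fun t (x : J -> pt G) => (forall j, t.2 j = inl (x j)) /\
    exists m, forall j, act m (t.1 j) (x j)) (imaginary_pow J iO')).
  apply: zd_and.
    apply: zd_all_fin => j; apply: (zfun_eq imaginary_ext_pt).
      by apply: (zfun_tracked imaginary_ext_pt); track.
    apply: (zfun_comp iO' (zfun_inl _ _ iO')).
    by apply: (zfun_tracked iO'); track.
  have z : zd (prod_coding (pow_coding J (old cO)) (pow_coding J (old cO)))
      (fun t => exists m, forall j, act m (t.1 j) (t.2 j)).
    exact: (@zd_lift_prod _ _ _ C _ _ (pow_coding J cO) (pow_coding J cO) _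
      (zd_same_map iM hO hGdef J)).
  by apply: (zd_pull (f := fun t => (t.1.1, t.2)) z); track.
apply: (zd_ex (P := fun t (s : J -> S) => (forall j, t.2 j = inr (s j)) /\
  exists m, forall j, act m (t.1 j) (sval (s j))) (imaginary_pow J iS)).
apply: zd_and.
  apply: zd_all_fin => j; apply: (zfun_eq imaginary_ext_pt).
    by apply: (zfun_tracked imaginary_ext_pt); track.
  apply: (zfun_comp iS (zfun_inr _ _ iS)).
  by apply: (zfun_tracked iS); track.
by apply: (zd_pull (f := fun t => (t.1.1, t.2)) zd_rel); track.
Qed.

(** The new relation does not compare two tuples of new points directly. Both tuples are compared
    with a tuple [z] of old points instead, and the two morphisms of [G] so obtained compose to the
    required one. *)
Lemma zd_related : zd (prod_coding (pow_coding J ext_pt_coding) (pow_coding J ext_pt_coding))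
  (fun t => related (K := K) t.1 t.2).
Proof.
have iO' := imaginary_lift C iO.
pose R (z : J -> pt G) (x : J -> pt G') :=
  exists m u, forall j, act m (z j) (real_pt (x j)) /\ loc (x j) = u.
apply: (@zd_ext _ _ _ _ (fun t => exists z, R z t.1 /\ R z t.2)).
  apply: (zd_ex (P := fun t z => R z t.1 /\ R z t.2) (imaginary_pow J iO')).
  apply: zd_and.
    by apply: (zd_pull (f := fun t => (t.2, t.1.1)) zd_real_related); track.
  by apply: (zd_pull (f := fun t => (t.2, t.1.2)) zd_real_related); track.
move=> [x y] /=; split=> [[z [[m [u mP]] [n [v nP]]]]|[m mP]].
  have smn : src m = src n.
    have [/(act_dom hg) [<- _] _] := mP None.
    by have [/(act_dom hg) [<- _] _] := nP None.
  have tm : tgt m = real_ob i u.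
    by have [/(act_dom hg) [_ <-] <-] := mP None; apply: real_loc.
  have tn : tgt n = real_ob i v.
    by have [/(act_dom hg) [_ <-] <-] := nP None; apply: real_loc.
  have [m' [sm' tm' m'P]] := act_inv hg m.
  have [|l [sl tl lP]] := act_comp hg (m := m') (m' := n); first by rewrite tm'.
  have sl' : src l = real_ob i u by rewrite sl sm'.
  have tl' : tgt l = real_ob i v by rewrite tl.
  exists (ExtMorphism sl' tl') => o; have [a1 e1] := mP o; have [a2 e2] := nP o.
  by split=> //; apply/lP; exists (z o); split=> //; apply/m'P.
have [n [sn tn nP]] := id_at (src (real_mor m)).
exists (fun j => real_pt (x j)); split.
  exists n, (ext_src m) => j; have [lx _ a] := mP j; split=> //.
  by apply: nP; have [] := act_dom hg a.
by exists (real_mor m), (ext_tgt m) => j; have [_ ly a] := mP j.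
Qed.

Definition ext_mor_coding : coding N (mor G') :=
  quot_coding (prod_coding (pow_coding K ext_pt_coding) (pow_coding K ext_pt_coding))
    (@rep A G q i K).

Lemma zd_snoc (Z : Type) (b : coding N Z) (f g : Z -> K -> pt G') (x y : Z -> pt G') :
  tracked b (pow_coding K ext_pt_coding) f -> tracked b (pow_coding K ext_pt_coding) g ->
  tracked b ext_pt_coding x -> tracked b ext_pt_coding y ->
  zd b (fun z => related (snoc (f z) (x z)) (snoc (g z) (y z))).
Proof.
move=> tf tg tx ty.
apply: (zd_pull (f := fun z => (snoc (f z) (x z), snoc (g z) (y z))) zd_related).
by apply: tracked_pair; apply: tracked_snoc.
Qed.

Lemma imaginary_ext_mor : imaginary_set ext_mor_coding.
Proof.
have iO' := imaginary_ext_pt; have iP := imaginary_pow K iO'.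
set c := prod_coding (pow_coding K ext_pt_coding) (pow_coding K ext_pt_coding).
pose E (z z' : (K -> pt G') * (K -> pt G')) := forall x y,
  related (snoc z.1 x) (snoc z.2 y) <-> related (snoc z'.1 x) (snoc z'.2 y).
apply: (@imaginary_quot _ _ _ _ c _ (fun t => E t.1 t.2)).
- exact: imaginary_prod.
- exact: (rep_fun hG si k0).
- exact: (rep_surj hG si k0 faithful).
- apply: (@zd_ext _ _ _ _ (fun t => base t.1 /\
      exists x y, related (snoc t.1 x) (snoc t.2 y))); last first.
    by move=> t; rewrite (rep_dom hG si k0).
  apply: zd_and.
    apply: (zd_all (P := fun t y => forall z, related (snoc t.1 y) (snoc t.1 z) -> y = z) iO').
    apply: (zd_all (P := fun t z => related (snoc t.1.1 t.2) (snoc t.1.1 z) -> t.2 = z) iO').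
    apply: zd_imp; last by apply: (zd_eq2 iO'); track.
    by apply: (zd_snoc (f := fun t => t.1.1.1) (g := fun t => t.1.1.1)
      (x := fun t => t.1.2) (y := fun t => t.2)); track.
  apply: (zd_ex (P := fun t x => exists y, related (snoc t.1 x) (snoc t.2 y)) iO').
  apply: (zd_ex (P := fun t y => related (snoc t.1.1 t.2) (snoc t.1.2 y)) iO').
  by apply: (zd_snoc (f := fun t => t.1.1.1) (g := fun t => t.1.1.2)
      (x := fun t => t.1.2) (y := fun t => t.2)); track.
- apply: (zd_all (P := fun t x => forall y, related (snoc t.1.1 x) (snoc t.1.2 y) <->
    related (snoc t.2.1 x) (snoc t.2.2 y)) iO').
  apply: (zd_all (P := fun t y => related (snoc t.1.1.1 t.2) (snoc t.1.1.2 y) <->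
    related (snoc t.1.2.1 t.2) (snoc t.1.2.2 y)) iO').
  apply: zd_iff.
    by apply: (zd_snoc (f := fun t => t.1.1.1.1) (g := fun t => t.1.1.1.2)
      (x := fun t => t.1.2) (y := fun t => t.2)); track.
  by apply: (zd_snoc (f := fun t => t.1.1.2.1) (g := fun t => t.1.1.2.2)
      (x := fun t => t.1.2) (y := fun t => t.2)); track.
- by move=> z z' m n rm rn; apply: (rep_eq hG si k0 rm rn).
Qed.

Lemma zfun_ext_src : zfun ext_mor_coding ext_ob_coding (@src G').
Proof.
have iO' := imaginary_ext_pt.
apply: zd_swap; apply: (zd_quot (Q := fun t => t.1 = loc (t.2.1 k0))).
  apply: (zfun_eq imaginary_ext_ob); first by apply: (zfun_tracked imaginary_ext_ob); track.
  apply: (zfun_comp iO' zfun_ext_loc); apply: (zfun_tracked iO').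
  by track.
by move=> u t m [_ /(_ k0)] [/= -> _ _].
Qed.

Lemma zfun_ext_tgt : zfun ext_mor_coding ext_ob_coding (@tgt G').
Proof.
have iO' := imaginary_ext_pt.
apply: zd_swap; apply: (zd_quot (Q := fun t => t.1 = loc (t.2.2 k0))).
  apply: (zfun_eq imaginary_ext_ob); first by apply: (zfun_tracked imaginary_ext_ob); track.
  apply: (zfun_comp iO' zfun_ext_loc); apply: (zfun_tracked iO').
  by track.
by move=> u t m [_ /(_ k0)] [/= _ -> _].
Qed.

Lemma zd_ext_act : zd (prod_coding (prod_coding ext_mor_coding ext_pt_coding) ext_pt_coding)
  (fun t => act (g := G') t.1.1 t.1.2 t.2).
Proof.
have z : zd (prod_coding (prod_coding ext_pt_coding ext_pt_coding) ext_mor_coding)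
    (fun t => act (g := G') t.2 t.1.1 t.1.2).
  apply: (zd_quot (Q := fun t => related (snoc t.2.1 t.1.1) (snoc t.2.2 t.1.2))).
    by apply: (zd_snoc (f := fun t => t.2.1) (g := fun t => t.2.2)
      (x := fun t => t.1.1) (y := fun t => t.1.2)); track.
  by move=> [x y] t m rm; apply: (rep_related hG si k0).
by apply: (zd_pull (f := fun t => ((t.1.2, t.2), t.1.1)) z); track.
Qed.

Lemma ext_zdef_family :
  zdef_family (old cA) (@ext_fam A G q i) ext_ob_coding ext_mor_coding ext_pt_coding.
Proof.
have iO' := imaginary_ext_pt; have iI' := imaginary_ext_ob; have iM' := imaginary_ext_mor.
have iA' := imaginary_lift C iA; split.
- exact: zdef_fun_of_zfun zfun_ext_fam.
- exact: zdef_fun_of_zfun zfun_ext_src.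
- exact: zdef_fun_of_zfun zfun_ext_tgt.
- exact: zdef_fun_of_zfun zfun_ext_loc.
- have iMO := imaginary_prod iM' iO'.
  apply: zdef_of_zd zd_ext_act; first exact: prod_code_fun.
  by apply: prod_code_dom; apply: imaginary_dom.
Qed.


(** * Internality of the fibres and automorphisms over [U] *)

Lemma faithful_points (a : A) : exists x : K -> S,
  faithful_tuple (i a) (fun k => sval (x k)).
Proof.
have [x xf] := faithful (i a).
have lx k : loc (x k) = i (q (loc (x k))) by rewrite (proj1 xf) si.
by exists (fun k => exist _ (x k) (lx k)).
Qed.

Lemma fibre_loc (a : A) (s : S) : p s = a <-> loc (sval s) = i a.
Proof. by split=> [<-|e]; [apply: (svalP s)|rewrite /cover_map e si]. Qed.

(** The bijection matches [s] with its underlying point. It is definable over a faithful tuple [x]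
    of the fibre together with the underlying points of [x]: a morphism witnessing the relation
    fixes the faithful tuple, so it is the identity and sends a point to [s] only if that point
    underlies [s]. *)
Lemma cover_internal (a : A) : internal (fun s : new_sort C => p s = a).
Proof.
have [x xf] := faithful_points a.
exists (cvar cO), (cty cO), (fun d => exists2 y, code cO d y & loc y = i a),
  (fun (s : S) d => p s = a /\ code cO d (sval s)); split.
- have [e ce] := code_surj iI (i a).
  have [phi phiP] := definable_of_Dfn e (zdef_loc hGdef).
  exists phi => d; rewrite phiP; split=> [[[y o] [/= cy co] oE]|[y cy ly]].
    by exists y => //; rewrite -oE; apply: (code_fun iI co ce).
  by exists (y, i a).
(* At the coordinate [None] the value [x k0] is a mere filler: [t] puts the two free variables
   there. *)
- pose e0 : env N rctx := fun v => match v return N (rctx v) with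
    | (o, Some w) => pcode hO (sval (x (odflt k0 o))) w
    | (o, None) => x (odflt k0 o)
    end.
  pose ty1 := ext_ty (old_ty (cover_syms cO J) (cty cO)) (None : lsort L').
  pose t (e : env N (sum_ty ty1 rctx)) : env N rctx := fun v =>
    match v return N (rctx v) with
    | (Some k, w) => e (inr (Some k, w))
    | (None, Some w) => e (inl (Some w))
    | (None, None) => e (inl None)
    end.
  have dt : dmap t.
    move=> [[k|] w]; first by exists (Var (sum_ty ty1 rctx) (inr (Some k, w))).
    by case: w => [w|]; [exists (Var (sum_ty ty1 rctx) (inl (Some w)))
                        |exists (Var (sum_ty ty1 rctx) (inl None))].
  have [phi phiP] := definable_of_Dfn e0 (Dfn_subst dt Dfn_rel_holds).
  exists phi => e; rewrite phiP; split=> [[m mP]|[/fibre_loc lx cx]].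
    have mx k : act m (sval (x k)) (sval (x k)).
      by have [o co] := mP (Some k); rewrite (pcode_eq (hO := hO) co).
    have [l1 l2] := act_dom hg (mx k0); rewrite (proj1 xf) in l1 l2.
    have [o /= co ao] := mP None; have [lo ls] := act_dom hg ao.
    have /(act_uniq hg ao) -> : act m o o by apply: (proj2 xf) => //; rewrite lo.
    by split=> //; apply/fibre_loc; rewrite ls.
  have [m [_ _ mP]] := id_at (i a); exists m => -[k|] /=.
    by exists (sval (x k)); [apply: pcodeP|apply: mP; apply: (proj1 xf)].
  by exists (sval (e None : S)) => //; apply: mP.
- by move=> s d [ps cd]; split=> //; exists (sval s) => //; apply/fibre_loc.
- move=> s ps; have [d cd] := code_surj iO (sval s); exists d; split=> // d' [_ cd'].
  exact: hO.2 cd cd'.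
- move=> d [y cy ly]; have ly' : loc y = i (q (loc y)) by rewrite ly si.
  exists (exist _ y ly'); split=> [|s [_ cs]]; first by split=> //; apply/fibre_loc.
  by apply: sval_inj => /=; apply: (code_fun iO cy cs).
Qed.

(** The relation holds between the underlying points of [x] and [s] and these elements themselves.
    As [sigma] fixes [U], it yields a morphism sending [x] and [s] to their images. These morphisms
    agree on the faithful tuple [x] as [s] varies, so one of them serves the whole fibre. *)
Lemma aut_over_mor (sigma : forall s, N s -> N s) (a : A) : aut_over sigma ->
  exists m : mor G, [/\ src m = i a, tgt m = i a &
    forall s : S, p s = a -> act m (sval s) (sval (sigma None s : S))].
Proof.
move=> [sa sU]; have [x xf] := faithful_points a.
have [n [sn tn nP]] := id_at (i a).
have H (s : S) : p s = a -> exists m : mor G,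
    (forall k, act m (sval (x k)) (sval (sigma None (x k) : S))) /\
    act m (sval s) (sval (sigma None s : S)).
  move=> /fibre_loc ls.
  pose e : env N rctx := fun v => match v return N (rctx v) with
    | (Some k, Some w) => pcode hO (sval (x k)) w
    | (Some k, None) => x k
    | (None, Some w) => pcode hO (sval s) w
    | (None, None) => s
    end.
  have he : rel_holds (i := i) (q := q) e.
    exists n => -[k|] /=.
      by exists (sval (x k)); [apply: pcodeP|apply: nP; apply: (proj1 xf)].
    by exists (sval s); [apply: pcodeP|apply: nP].
  have := aut_rel sa (r := inr tt) (fun k => e (enum_val k)).
  rewrite /= (unrank_val (T := fun v => ext_carrier U S (rel_ctx v)) e).
  rewrite (unrank_val (T := fun v => ext_carrier U S (rel_ctx v)) (fun v => sigma _ (e v))).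
  move=> [_ /(_ he)] [m mP]; exists m; split.
    move=> k; have [o co] := mP (Some k).
    rewrite (_ : (fun w => _) = pcode hO (sval (x k))) in co; last first.
      by apply: functional_extensionality_dep => w; apply: sU.
    by rewrite (pcode_eq co).
  have [o co] := mP None.
  rewrite (_ : (fun w => _) = pcode hO (sval s)) in co; last first.
    by apply: functional_extensionality_dep => w; apply: sU.
  by rewrite (pcode_eq co).
have px k : p (x k) = a by apply/fibre_loc; apply: (proj1 xf).
have [m [mx _]] := H _ (px k0).
have sm : src m = i a by have [<- _] := act_dom hg (mx k0); apply: (proj1 xf).
exists m; split=> //.
  have [_ <-] := act_dom hg (mx k0); rewrite (svalP (sigma None (x k0) : S)).
  congr i; have [_ ->] := act_dom hg (mx k0).
  by rewrite -(fam_mor hG m) sm si.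
move=> s ps; have [m' [m'x m's]] := H _ ps.
exact: (faithful_act hG k0 xf m'x mx m's).
Qed.

Lemma move_aut_over (m : A -> mor G) (ms : forall a, src (m a) = i a)
    (mt : forall a, tgt (m a) = i a) :
  @aut_over L U _ C (@move_elt _ _ _ _ _ cO hG J i i si m ms mt).
Proof.
split=> //; split.
- move=> s; apply: bijective_of_inj_surj; first exact: move_inj.
  exact: move_surj.
- by move=> r x; apply: move_rel; last exact: si; apply: None.
- by move=> f x; apply: move_fun.
Qed.

Lemma aut_fibre_mor (a : A) (g : aut_fibre p a) : exists m : mor G,
  [/\ src m = i a, tgt m = i a &
    forall s : fibre p a, act m (sval (sval s : S)) (sval (sval (sval g s) : S))].
Proof.
case: g => g [sigma sa sg] /=; have [m [sm tm mP]] := aut_over_mor a sa.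
by exists m; split=> // s; rewrite sg; apply: mP; apply: (svalP s).
Qed.

Lemma cover_independent : independent_fibres p.
Proof.
move=> g; have /choice [m mP] a := aut_fibre_mor (g a).
have ms a : src (m a) = i a by case: (mP a).
have mt a : tgt (m a) = i a by case: (mP a).
have res a : restricts (@move_elt _ _ _ _ _ cO hG J i i si m ms mt) (sval (g a)).
  move=> s; apply: sval_inj; have [_ _ /(_ s) h] := mP a.
  have := move_act hG si ms mt (sval s : S).
  by rewrite [q _](svalP s) => h'; apply: (act_uniq hg h h').
exists (@move_elt _ _ _ _ _ cO hG J i i si m ms mt); split=> //.
  exact: move_aut_over.
move=> tau [_ tU] tr [s|] x; first exact: tU.
by rewrite -(tr (p x) (exist _ x erefl)) -(res (p x) (exist _ x erefl)).
Qed.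

Lemma mor_aut_fibre (a : A) (m : mor G) : src m = i a -> tgt m = i a ->
  exists g : aut_fibre p a,
    forall s : fibre p a, act m (sval (sval s : S)) (sval (sval (sval g s) : S)).
Proof.
move=> sm tm.
(* The prescribed morphism is used over [a] and some endomorphism of [i b] over every other [b]. *)
have /choice [n nP] b : exists n : mor G, [/\ src n = i b, tgt n = i b & b = a -> n = m].
  have [->|ne] := EM (b = a); first by exists m.
  by have [n [sn tn _]] := id_at (i b); exists n.
have ns b : src (n b) = i b by case: (nP b).
have nt b : tgt (n b) = i b by case: (nP b).
pose sigma := @move_elt _ _ _ _ _ cO hG J i i si n ns nt.
have sa : @aut_over L U _ C sigma := move_aut_over ns nt.
have pg (s : fibre p a) : p (sigma None (sval s)) = a.
  by apply: (etrans (move_fam hG si ns nt (sval s))); apply: (svalP s).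
pose g (s : fibre p a) : fibre p a := exist _ (sigma None (sval s)) (pg s).
have ga : exists2 sigma, aut_over sigma & restricts sigma g by exists sigma.
exists (exist _ g ga) => s; have := move_act hG si ns nt (sval s : S).
have [_ _ /(_ (svalP s)) ->] := nP (q (loc (sval (sval s : S)))); exact.
Qed.

(** [phi] sends a morphism to the permutation of the fibre that it induces. Injectivity holds
    because morphisms are determined by their graphs, surjectivity because automorphisms over [U]
    act on a fibre through morphisms. *)
Lemma ext_action_isomorphic (a : A) :
  action_isomorphic (G' := G') p inr inr a.
Proof.
have hg' := ext_groupoidP hG si.
have /choice [phi phiP] (m : vertex_group (G := G') (inr a)) :
    exists g : aut_fibre p a, forall s : fibre p a,
      act (sval m) (inr (sval s)) (inr (sval (sval g s))).
  case: m => m [sm tm] /=; have [||g gP] := @mor_aut_fibre a (real_mor m).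
  - by rewrite real_src [ext_src m]sm.
  - by rewrite real_tgt [ext_tgt m]tm.
  exists g => s; split; last exact: gP.
    by rewrite [RHS]sm /=; congr inr; apply: (svalP s).
  by rewrite [RHS]tm /=; congr inr; apply: (svalP (sval g s)).
have phi_eq (m : vertex_group (G := G') (inr a)) (g : aut_fibre p a) :
    (forall s : fibre p a, act (sval m) (inr (sval s)) (inr (sval (sval g s)))) ->
    phi m = g.
  move=> h; apply: sval_inj; apply: funext => s; apply: sval_inj.
  by have [] := act_uniq hg' (phiP m s) (h s).
exists phi; split=> //.
- apply: bijective_of_inj_surj => [m n mn|g].
    apply: sval_inj; apply: (mor_ext hg').
      by have [-> _] := svalP m; have [-> _] := svalP n.
    move=> x y axy; have [lx ly] := act_dom hg' axy.
    have [sm tm] := svalP m; rewrite sm in lx.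
    case: x lx axy => // s [ls] axy.
    have := phiP m (exist _ s ls); rewrite mn => /(act_uniq hg' axy) ->.
    exact: (phiP n (exist _ s ls)).
  have [m [sm tm mP]] := aut_fibre_mor g.
  pose m' := @ExtMorphism A G i (inr a) (inr a) m sm tm.
  have vm : @src G' m' = inr a /\ @tgt G' m' = inr a by [].
  exists (exist _ m' vm); apply: phi_eq => s; split=> //=; congr inr.
    exact: (svalP s).
  exact: (svalP (sval g s)).
- move=> m1 m2 m3 m12 s; apply: sval_inj.
  have a3 : act (sval m3) (inr (sval s) : pt G')
      (inr (sval (sval (phi m2) (sval (phi m1) s)))).
    by apply/m12; exists (inr (sval (sval (phi m1) s))); split.
  by have [] := act_uniq hg' (phiP m3 s) a3.
Qed.

Lemma ext_one_object (a : A) :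
  one_object_extension p q (G' := G') (@ext_fam A G q i) inl inl inr inr a.
Proof.
split.
- move=> [o|b] /=; split.
  + by move=> qo; left; exists o.
  + by case=> [[o' qo' [<-]]|].
  + by move=> ->; right.
  + by case=> [[]|[->]].
- by move=> u v _ _ [].
- by [].
- move=> u qu [x|s] /=; split.
  + by move=> [lx]; exists x.
  + by move=> [y ly [<-]]; rewrite ly.
  + by [].
  + by case.
- by move=> x y _ _ [].
- move=> [x|s] /=; split.
  + by [].
  + by case.
  + by move=> [ps]; exists s.
  + by move=> [t pt [<-]]; congr inr.
- by move=> s t _ _ [].
- move=> u v qu qv m sm tm; exists (@ExtMorphism A G i (inl u) (inl v) m sm tm).
  split=> // x y lx ly; split=> [axy|[]] //.
  by split=> //=; congr inl.
- move=> u v qu qv m sm tm; exists (real_mor m); split.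
  + by rewrite real_src [ext_src m]sm.
  + by rewrite real_tgt [ext_tgt m]tm.
  move=> x y lx ly; split=> [axy|[]] //; split=> //=.
    by rewrite [RHS]sm lx.
  by rewrite [RHS]tm ly.
Qed.

End CoverGroupoid.

(** * A uniform length for faithful tuples *)

(** The objects without a faithful tuple of length [n + 1] form definable sets decreasing in [n]. If
    none of them were empty, saturation would give an object lying in all of them, against finite
    faithfulness at that object. *)
Lemma uniform_faithful (L : language) (U : structure L) (A : Type) (G : groupoid_data)
    (q : ob G -> A) (cA : coding U A) (cI : coding U (ob G)) (cM : coding U (mor G))
    (cO : coding U (pt G)) :
  saturated U -> card_lt nat (elt U) -> imaginary_set cI -> imaginary_set cM ->
  imaginary_set cO -> connected_family q -> zdef_family cA q cI cM cO ->
  finitely_faithful G ->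
  exists n, forall u : ob G, exists x : 'I_n.+1 -> pt G, faithful_tuple u x.
Proof.
move=> satU nU iI iM iO hG hGdef hff; have hg := fam_groupoid hG.
apply: contrapT => /forallNP nofaith.
pose X (n : nat) (u : ob G) := ~ exists x : 'I_n.+1 -> pt G, faithful_tuple u x.
have Xle m n u : m <= n -> X n u -> X m u.
  move=> mn xn [x [xu xf]]; apply: xn.
  (* A tuple is lengthened by repeating its last entry, which does not change its stabiliser. *)
  exists (fun k => x (inord (minn k m))); split=> // h sh th hx; apply: xf => // k.
  have kn : k < n.+1 by apply: leq_trans (ltn_ord k) _.
  have := hx (Ordinal kn); rewrite (_ : inord _ = k) //; apply: val_inj.
  by rewrite /= inordK (minn_idPl _) // -ltnS.
have zX n : zd cI (X n).
  apply: zd_not.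
  apply: (zd_ex (P := fun u (x : 'I_n.+1 -> pt G) => faithful_tuple u x)
    (imaginary_pow 'I_n.+1 iO)).
  set c := prod_coding cI (pow_coding _ cO).
  have zl : zfun cO cI loc by apply: zd_of_zdef (zdef_loc hGdef); apply: imaginary_prod.
  have zs : zfun cM cI src by apply: zd_of_zdef (zdef_src hGdef); apply: imaginary_prod.
  have zt : zfun cM cI tgt by apply: zd_of_zdef (zdef_tgt hGdef); apply: imaginary_prod.
  have za : zd (prod_coding (prod_coding cM cO) cO) (fun t => act t.1.1 t.1.2 t.2).
    by apply: zd_of_zdef (zdef_act hGdef); do !apply: imaginary_prod.
  apply: zd_and.
    apply: zd_all_fin => k; apply: (zfun_eq iI); last by apply: (zfun_tracked iI); track.
    by apply: (zfun_comp iO zl); apply: (zfun_tracked iO); track.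
  apply: (zd_all (P := fun t m => src m = t.1 -> tgt m = t.1 ->
    (forall k, act m (t.2 k) (t.2 k)) -> forall y, loc y = t.1 -> act m y y) iM).
  apply: zd_imp; last apply: zd_imp; last apply: zd_imp.
  - apply: (zfun_eq iI); last by apply: (zfun_tracked iI); track.
    by apply: (zfun_comp iM zs); apply: (zfun_tracked iM); track.
  - apply: (zfun_eq iI); last by apply: (zfun_tracked iI); track.
    by apply: (zfun_comp iM zt); apply: (zfun_tracked iM); track.
  - apply: zd_all_fin => k.
    by apply: (zd_pull (f := fun t => ((t.2, t.1.2 k), t.1.2 k)) za); track.
  - apply: (zd_all (P := fun t y => loc y = t.1.1 -> act t.2 y y) iO); apply: zd_imp.
      apply: (zfun_eq iI); last by apply: (zfun_tracked iI); track.
      by apply: (zfun_comp iO zl); apply: (zfun_tracked iO); track.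
    by apply: (zd_pull (f := fun t => ((t.1.2, t.2), t.2)) za); track.
pose e0 : env U (of_void (lsort L)) := fun v => match v with end.
have [||l|e eP] := realize satU nU (W := cvar cI) (ty' := cty cI) (e := e0)
  (X := fun (n : nat) _ e => exists2 u, code cI e u & X n u).
- by move=> [f _]; apply: nU; exists (fun x => match f x with end) => x; case: (f x).
- move=> n; have dX := zdef_of_zd (code_fun iI) (imaginary_dom iI) (zX n).
  exact: Dfn_subst (@dmap_envr _ _ _ _ _ _) dX.
(* The sets decrease, so the condition with the largest index in the list implies the others. *)
- have [n nE] : exists n, n = foldr maxn 0 l by eexists.
  have /existsNP [u nu] := nofaith n.
  have [e ce] := code_surj iI u; exists e => m ml; exists u => //.
  apply: (Xle m n) nu; rewrite {}nE; elim: l ml => //= k l IH [->|/IH h].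
    exact: leq_maxl.
  exact: leq_trans h (leq_maxr _ _).
have [u cu _] := eP 0; have [l lu lf] := hff u.
have [y ly] := loc_surj hg u.
have [u' cu' []] := eP (size l); rewrite -(code_fun iI cu cu').
have nth_in k : k < size l -> List.In (nth y l k) l.
  elim: l {lu lf} k => //= z l IH [|k] kl; [by left|right; exact: IH].
have in_nth x : List.In x l -> exists2 k, k < size l & nth y l k = x.
  elim: l {lu lf nth_in} => //= z l IH [->|/IH [k kl kx]]; first by exists 0.
  by exists k.+1.
(* Indices run up to [size l], where [nth] returns its default [y], a point of [u]; the tuple is
   thus nonempty even when [l] is empty. *)
exists (fun k => nth y l k); split=> [k|m sm tm mx].
  have [kl|kl] := ltnP k (size l); last by rewrite nth_default.
  exact: lu (nth_in _ kl).
apply: lf => // x /in_nth [k kl <-].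
exact: (mx (Ordinal (ltnW kl : k < (size l).+1))).
Qed.

Theorem theorem5p6
  (L : language) (T : sentence L -> Prop)
  (hT : complete_theory T) (hEI : theory_elim_imaginaries T)
  (U : structure L) (hU : model T U) (hmonster : monster U)
  (A : Type) (cA : coding U A) (hA : real_set cA)
  (G : groupoid_data) (q : ob G -> A)
  (cI : coding U (ob G)) (cM : coding U (mor G)) (cO : coding U (pt G))
  (hI : real_set cI) (hM : real_set cM) (hO : real_set cO)
  (hG : connected_family q) (hGdef : zdef_family cA q cI cM cO)
  (hff : finitely_faithful G) :
  exists (X : new_symbols L) (C : expansion U X) (p : new_sort C -> A),
    analysable_cover cA p /\ independent_fibres p /\
    exists (G' : groupoid_data) (q' : ob G' -> A)
      (cI' : coding (exp_str C) (ob G')) (cM' : coding (exp_str C) (mor G'))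
      (cO' : coding (exp_str C) (pt G')),
      imaginary_set cI' /\ imaginary_set cM' /\ imaginary_set cO' /\
      connected_family q' /\ zdef_family (lift_coding C cA) q' cI' cM' cO' /\
      exists (jo : ob G -> ob G') (jp : pt G -> pt G')
        (star : A -> ob G') (k : new_sort C -> pt G'),
        zdef_fun (lift_coding C cI) cI' jo /\ zdef_fun (lift_coding C cO) cO' jp /\
        zdef_fun (lift_coding C cA) cI' star /\ zdef_fun (new_coding C) cO' k /\
        forall a : A,
          one_object_extension p q q' jo jp star k a /\
          action_isomorphic p star k a.
Proof.
have [satU bigU] := hmonster.
have nU : card_lt nat (elt U).
  move=> Un; apply: bigU; apply: (embeds_trans Un).
  by exists (fun n => inl (inl (inl n))) => m n [].
(* If every sort had at most one element, the elements of [U] would inject into the sorts of [L],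
   against the size of a monster model. The two distinct elements tag the summands in the codings of
   old and new objects and points. *)
have [s2 [b0 [b1 b01]]] : exists s (x y : U s), x <> y.
  apply: contrapT => noS; apply: bigU.
  exists (fun b => inl (inl (inr (projT1 b)))) => -[s x] [t y] /= [E]; subst t.
  by congr existT; apply: contrapT => ne; apply: noS; exists s, x, y.
have [iA iI iM iO] : [/\ imaginary_set cA, imaginary_set cI, imaginary_set cM &
  imaginary_set cO] by split; [case: hA|case: hI|case: hM|case: hO].
have [n faithful] := uniform_faithful satU nU iI iM iO hG hGdef hff.
have /choice [i si] := fam_surj hG.
(* [K] indexes the faithful tuples and is inhabited, so that a tuple determines its object; the
   extra index in [option K] carries the point whose image is being described. *)
pose K : finType := 'I_n.+1; pose k0 : K := ord0.
pose C := groupoid_cover q cO (option K : finType) i.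
have iN := imaginary_new q cO K i; have iA' := imaginary_lift C iA.
have iI' := imaginary_ext_ob q cO iA iI K i b01.
have iO' := imaginary_ext_pt hO hG K si b01.
have iM' := imaginary_ext_mor iM hO hG hGdef k0 faithful si b01.
exists (cover_syms cO (option K : finType)), C, (@cover_map L U A G q cO K i); split.
  split.
  - exact: (cover_saturated iA iI iM hO hG hGdef (None : (option K : finType)) satU nU si).
  - exact: (cover_stably_embedded iA iI iM hO hG hGdef (None : (option K : finType)) si).
  - exact: cover_finitely_generated.
  - move=> a; have [x lx] := loc_surj (fam_groupoid hG) (i a).
    have lx' : loc x = i (q (loc x)) by rewrite lx si.
    by exists (exist _ x lx'); rewrite /cover_map /= lx si.
  - exact: zdef_fun_of_zfun (zfun_cover_map iA iI hO hG hGdef K i).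
  - exact: (cover_internal iI hO hG hGdef k0 faithful si).
split; first exact: (cover_independent hO hG k0 faithful si).
exists (ext_groupoid q i), (@ext_fam A G q i), (ext_ob_coding q cA cI cO K i s2),
  (ext_mor_coding q cO K i s2), (ext_pt_coding q cO K i s2).
do 3!split=> //; split; first exact: ext_connected.
split; first exact: (ext_zdef_family iA iI iM hO hG hGdef k0 faithful si b01).
exists inl, inl, inr, inr.
have iI1 := imaginary_lift C iI; have iO1 := imaginary_lift C iO.
split; first exact: zdef_fun_of_zfun (zfun_inl _ _ iI1).
split; first exact: zdef_fun_of_zfun (zfun_inl _ _ iO1).
split; first exact: zdef_fun_of_zfun (zfun_inr _ _ iA').
split; first exact: zdef_fun_of_zfun (zfun_inr _ _ iN).
move=> a; split; first exact: ext_one_object.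
exact: (ext_action_isomorphic hO hG k0 faithful si a).
Qed.
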